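(* Let $X=\{(\Lambda_k,m^{(k)})\}_{k\ge1}$ be an array satisfying $\lim_{k\to\infty}\frac1k\sup_{\lambda\in\Lambda_k}m_\lambda=0$, and suppose $X$ is an $L^2$-sampling array for $\{\mathcal P_k\}$. Then: (a) $X$ has finite overlap, i.e. $S_X:=\sup_{k\ge1}\sup_{z\in\mathbb C}\sum_{\lambda\in\Lambda_k}\chi_{D_{\lambda,m_\lambda}}(z)<\infty$, where $D_{\lambda,m_\lambda}=D(\lambda,\sqrt{m_\lambda/k})$ for $\lambda\in\Lambda_k$; (b) there exist $c>0$ and $k_0\in\mathbb N$ such that for all $k\ge k_0$, $$\bigcup_{\lambda\in\Lambda_k}D\Bigl(\lambda,\frac{\sqrt{m_\lambda}+c}{\sqrt k}\Bigr)=\mathbb C.$$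
   Context: $\mathcal P_k$ is the space of holomorphic polynomials in one complex variable of degree at most $k$. Let $d\nu(z)=\frac{dm(z)}{\pi(1+|z|^2)^2}$ on $\mathbb C$. $\mathcal P_k$ carries the inner product $\langle p,q\rangle_k=(k+1)\int_{\mathbb C}p\,\bar q\,\frac{d\nu}{(1+|z|^2)^k}$ and norm $\|p\|_{k,2}=\langle p,p\rangle_k^{1/2}$; $e_{k,j}(z)=\binom{k}{j}^{1/2}z^j$, $j=0,\dots,k$, is an orthonormal basis. Chordal distance $d(z,w)=\frac{|z-w|}{(1+|z|^2)^{1/2}(1+|w|^2)^{1/2}}$, $D(z,r)=\{w: d(z,w)<r\}$. For $\lambda\in\mathbb C$, $\varphi_\lambda(z)=\frac{\lambda-z}{1+\bar\lambda z}$ and $T_\lambda p(z)=\frac{(1+\bar\lambda z)^k}{(1+|\lambda|^2)^{k/2}}p(\varphi_\lambda(z))$. An array $X=\{(\Lambda_k,m^{(k)})\}_{k\ge1}$ consists of finite sets $\Lambda_k\subset\mathbb C$ with positive integer multiplicities $m_\lambda$, $\lambda\in\Lambda_k$. $X$ is $L^2$-sampling if there is $C>0$ such that for all $k\ge1$ and all $p\in\mathcal P_k$, $\frac1C\|p\|_{k,2}^2\le\sum_{\lambda\in\Lambda_k}\sum_{j=0}^{m_\lambda-1}|\langle p,T_\lambda e_{k,j}\rangle_k|^2\le C\|p\|_{k,2}^2.$ *)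

(* Defs.v *)
From HB Require Import structures.
From mathcomp Require Import all_boot all_order all_algebra.
From mathcomp Require Import all_classical all_reals all_analysis.
From mathcomp Require Import complex.
Set Implicit Arguments. Unset Strict Implicit. Unset Printing Implicit Defensive.
Import Order.TTheory GRing.Theory Num.Theory.
Import numFieldNormedType.Exports.
Local Open Scope ring_scope.

Section SamplingDefs.
Variable R : realType.
Local Notation C := R[i].
Local Notation normc := (@ComplexField.Normc.normc R).

Definition cpt (xy : R * R) : C := Complex xy.1 xy.2.

Definition lebC := (@lebesgue_measure R \x @lebesgue_measure R)%E.

(* density of dnu w.r.t. Lebesgue measure times the weight (1+|z|^2)^{-k}:
   1 / (pi (1+|z|^2)^2 (1+|z|^2)^k) *)
Definition wt (k : nat) (z : C) : R :=
  (pi * (1 + normc z ^+ 2) ^+ 2 * (1 + normc z ^+ 2) ^+ k)^-1.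

Definition ipk (k : nat) (f g : C -> C) : C :=
  let h := fun xy : R * R => f (cpt xy) * conjc (g (cpt xy)) in
  Complex
    (k.+1%:R * \int[lebC]_(xy in setT) (complex.Re (h xy) * wt k (cpt xy)))
    (k.+1%:R * \int[lebC]_(xy in setT) (complex.Im (h xy) * wt k (cpt xy))).

(* ||p||_{k,2} = <p,p>_k^{1/2}  (<p,p>_k is real) *)
Definition normk (k : nat) (f : C -> C) : R := Num.sqrt (complex.Re (ipk k f f)).

(* orthonormal basis e_{k,j}(z) = binom(k,j)^{1/2} z^j *)
Definition ekj (k j : nat) : {poly C} := (Num.sqrt ('C(k, j)%:R : R))%:C%C *: 'X^j.

Definition phi (l z : C) : C := (l - z) / (1 + conjc l * z).

Definition Tl (k : nat) (l : C) (p : {poly C}) : C -> C :=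
  fun z => (1 + conjc l * z) ^+ k / ((Num.sqrt (1 + normc l ^+ 2)) ^+ k)%:C%C
           * p.[phi l z].

Definition dch (z w : C) : R :=
  normc (z - w) / (Num.sqrt (1 + normc z ^+ 2) * Num.sqrt (1 + normc w ^+ 2)).

Definition Dch (z : C) (r : R) : set C := [set w | dch z w < r].

(* An array X = {(Lam k, m k)}_{k>=1}: Lam k is a finite set (duplicate-free
   list) of points, m k l the positive multiplicity of l in Lam k. *)
Definition is_array (Lam : nat -> seq C) (m : nat -> C -> nat) : Prop :=
  forall k, (1 <= k)%N -> uniq (Lam k) /\ (forall l, l \in Lam k -> (0 < m k l)%N).

Definition samp_sum (Lam : nat -> seq C) (m : nat -> C -> nat) (k : nat)
    (p : {poly C}) : R :=
  \sum_(l <- Lam k) \sum_(j < m k l) normc (ipk k (fun z => p.[z]) (Tl k l (ekj k j))) ^+ 2.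

Definition L2_sampling (Lam : nat -> seq C) (m : nat -> C -> nat) : Prop :=
  exists Cst : R, 0 < Cst /\
    forall k, (1 <= k)%N -> forall p : {poly C}, (size p <= k.+1)%N ->
      Cst^-1 * normk k (fun z => p.[z]) ^+ 2 <= samp_sum Lam m k p
      /\ samp_sum Lam m k p <= Cst * normk k (fun z => p.[z]) ^+ 2.

End SamplingDefs.

(* Main.v *)
Require Import Defs.
From HB Require Import structures.
From mathcomp Require Import all_boot all_order all_algebra.
From mathcomp Require Import ring lra zify.
From mathcomp Require Import all_classical all_reals all_analysis.
From mathcomp Require Import measurable_realfun.
From mathcomp Require Import complex.
Set Implicit Arguments. Unset Strict Implicit. Unset Printing Implicit Defensive.
Import Order.TTheory GRing.Theory Num.Theory.
Import numFieldNormedType.Exports.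
Local Open Scope classical_set_scope.
Local Open Scope ring_scope.

(** In homogeneous coordinates [T_l e_j] is [sqrt 'C(k, j)] times a product of
    powers of the linear forms attached to [l] and to its antipode. Hence, for
    the coherent state [K_z = T_z e_0], the numbers [|<K_z, T_l e_j>|^2] are the
    weights of the binomial law with parameters [k] and [d(l, z)^2], and the
    contribution of [l] to the sampling sum is [P(Bin < m_l)].

    (a) This contribution is at least [1/24] as soon as [z] is in the disc of
    [l], so the upper sampling inequality for [K_z] bounds the overlap.

    (b) Put [tau_l = sqrt k * d(l, z) - sqrt m_l] and suppose [tau_l >= c] for
    all [l]. The lower sampling inequality for [K_z] and Chernoff's bound give
    [1/C <= sum_l exp (- tau_l^2)]. The upper inequality for the [T_z e_n]
    makes this sum small: the projection onto the span of
    the [T_l e_j], [j < m_l], has trace at least [1/96] on the span of the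
    [T_z e_n], [n <= 128 tau_l^2], as one sees by testing it on the coherent
    state at the point of the geodesic from [l] to [z] at distance
    [sqrt (m_l / k)] from [l]. So [exp (- tau_l^2)] is at most
    [96 exp (- c^2 / 2) sum_(n, j) q^n |<T_z e_n, T_l e_j>|^2] with a fixed
    [q < 1], and summing over [l] first gives [O(exp (- c^2 / 2))]. *)

(** * Binomial tails *)

Section Binomial.
Variable R : realType.
Implicit Types (k j m : nat) (p x : R) (f g : nat -> R).

Definition bpmf k p j : R := 'C(k, j)%:R * p ^+ j * (1 - p) ^+ (k - j).

Definition bexp k p f : R := \sum_(j < k.+1) f j * bpmf k p j.

Lemma bpmf_ge0 k p j : 0 <= p <= 1 -> 0 <= bpmf k p j.
Proof.
by move=> /andP[p0 p1]; rewrite !mulr_ge0 ?exprn_ge0 // subr_ge0.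
Qed.

Lemma bpmf_small k p j : (k < j)%N -> bpmf k p j = 0.
Proof. by move=> kj; rewrite /bpmf bin_small // !mul0r. Qed.

Lemma bpmfS0 k p : bpmf k.+1 p 0 = (1 - p) * bpmf k p 0.
Proof. by rewrite /bpmf !bin0 !subn0 exprS !expr0; ring. Qed.

Lemma bpmfSS k p j : bpmf k.+1 p j.+1 = (1 - p) * bpmf k p j.+1 + p * bpmf k p j.
Proof.
rewrite /bpmf binS natrD subSS.
case: (ltnP j k) => [jk|kj].
  by rewrite -(subnSK jk) !exprS; ring.
rewrite (bin_small (_ : k < j.+1)%N) // !exprS.
have -> : (k - j = 0)%N by apply/eqP; rewrite subn_eq0.
by ring.
Qed.

Lemma bexp0 p f : bexp 0 p f = f 0%N.
Proof. by rewrite /bexp big_ord1 /bpmf bin0 subnn !expr0; ring. Qed.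

(** Condition on one trial: a success, of probability [p], shifts the count by one. The moments, the
    generating function and the monotonicity in [p] follow from this recursion by induction on
    [k]. *)
Lemma bexpS k p f : bexp k.+1 p f = (1 - p) * bexp k p f + p * bexp k p (f \o succn).
Proof.
rewrite /bexp big_ord_recl /= bpmfS0.
under eq_bigr => j _ do rewrite /bump /= add1n bpmfSS mulrDr.
rewrite big_split /= big_ord_recr /= (@bpmf_small k _ k.+1) // mulr0 mulr0 addr0.
rewrite [in RHS]big_ord_recl mulrDr !mulr_sumr addrA; congr (_ + _ + _).
- by rewrite !mulrA (mulrC (1 - p)).
- by apply: eq_bigr => j _; rewrite mulrCA.
- by apply: eq_bigr => j _; rewrite mulrCA.
Qed.

Lemma bexpD k p f g : bexp k p (fun j => f j + g j) = bexp k p f + bexp k p g.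
Proof. by rewrite /bexp -big_split; apply: eq_bigr => j _; rewrite mulrDl. Qed.

Lemma bexpZ k p (c : R) f : bexp k p (fun j => c * f j) = c * bexp k p f.
Proof. by rewrite /bexp mulr_sumr; apply: eq_bigr => j _; rewrite mulrA. Qed.

Lemma eq_bexp k p f g : f =1 g -> bexp k p f = bexp k p g.
Proof. by move=> fg; apply: eq_bigr => j _; rewrite fg. Qed.

Lemma le_bexp k p f g : 0 <= p <= 1 -> (forall j, f j <= g j) ->
  bexp k p f <= bexp k p g.
Proof.
by move=> p01 fg; apply: ler_sum => j _; apply: ler_wpM2r => //; exact: bpmf_ge0.
Qed.

Lemma bexp_cst k p (c : R) : bexp k p (fun=> c) = c.
Proof.
elim: k => [|k IH]; first by rewrite bexp0.
by rewrite bexpS IH; ring.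
Qed.

Lemma sum_bpmf k p : \sum_(j < k.+1) bpmf k p j = 1.
Proof. by rewrite -(bexp_cst k p 1); apply: eq_bigr => j _; rewrite mul1r. Qed.

Lemma bexp_geom k p x : bexp k p (fun j => x ^+ j) = (1 - p + p * x) ^+ k.
Proof.
elim: k => [|k IH]; first by rewrite bexp0.
rewrite bexpS IH (eq_bexp _ _ (g := fun j => x * x ^+ j)); last first.
  by move=> j; rewrite /= exprS.
by rewrite bexpZ IH exprS; ring.
Qed.

Let shiftE x j : x - j.+1%:R = (x - 1) - j%:R.
Proof. by rewrite -natr1; ring. Qed.

Lemma bexp_id k p : bexp k p (fun j => j%:R) = k%:R * p.
Proof.
elim: k => [|k IH]; first by rewrite bexp0 mul0r.
rewrite bexpS IH (eq_bexp _ _ (g := fun j => j%:R + 1)); last first.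
  by move=> j; rewrite /= natr1.
by rewrite bexpD IH bexp_cst -natr1; ring.
Qed.

Lemma bexp_dev1 k p x : bexp k p (fun j => x - j%:R) = x - k%:R * p.
Proof.
rewrite (eq_bexp _ _ (g := fun j => x + (-1) * j%:R)); last by move=> j; ring.
by rewrite bexpD bexp_cst bexpZ bexp_id; ring.
Qed.

(** The centre [x] is arbitrary because the induction step replaces it by [x - 1]. *)
Lemma bexp_dev2 k p x :
  bexp k p (fun j => (x - j%:R) ^+ 2) = (x - k%:R * p) ^+ 2 + k%:R * (p * (1 - p)).
Proof.
elim: k x => [|k IH] x; first by rewrite bexp0; ring.
rewrite bexpS IH (eq_bexp _ _ (g := fun j => (x - 1 - j%:R) ^+ 2)); last first.
  by move=> j; rewrite /= shiftE.
by rewrite IH -natr1; ring.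
Qed.

(** Expansion about the mean: [s], [s * (1 - 2 * p)] and the last summand are the central moments of
    order two, three and four. *)
Lemma bexp_dev4 k p x :
  bexp k p (fun j => (x - j%:R) ^+ 4) =
  let c := x - k%:R * p in let s := k%:R * (p * (1 - p)) in
  c ^+ 4 + 6 * c ^+ 2 * s - 4 * c * (s * (1 - 2 * p))
  + s * (1 + 3 * (k%:R - 2) * (p * (1 - p))).
Proof.
elim: k x => [|k IH] x; first by rewrite bexp0 /=; ring.
rewrite bexpS IH (eq_bexp _ _ (g := fun j => (x - 1 - j%:R) ^+ 4)); last first.
  by move=> j; rewrite /= shiftE.
by rewrite IH /= -natr1; ring.
Qed.

Definition blow k p m : R := \sum_(j < m) bpmf k p j.

Lemma blowE k p m : blow k p m = bexp k p (fun j => (j < m)%N%:R).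
Proof.
(* [m] may lie on either side of [k.+1], so both sums are extended to the larger bound; the terms
   with [j > k] vanish. *)
transitivity (\sum_(j < maxn m k.+1) (j < m)%N%:R * bpmf k p j).
  rewrite /blow (big_ord_widen _ (bpmf k p) (leq_maxl m k.+1)) big_mkcond /=.
  by apply: eq_bigr => j _; case: ifP; rewrite ?mul1r ?mul0r.
rewrite /bexp (big_ord_widen _ (fun j => (j < m)%N%:R * bpmf k p j) (leq_maxr m k.+1)).
rewrite [RHS]big_mkcond /=; apply: eq_bigr => j _.
by case: ifP => // /negbT; rewrite -leqNgt => jk; rewrite bpmf_small ?mulr0.
Qed.

Lemma blow_mono k p m n : 0 <= p <= 1 -> (m <= n)%N -> blow k p m <= blow k p n.
Proof.
move=> p01 mn; rewrite !blowE; apply: le_bexp => // j.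
by rewrite ler_nat; case: (ltnP j m) => // jm; rewrite (leq_trans jm mn).
Qed.

Lemma blowS k p m : blow k.+1 p m = (1 - p) * blow k p m + p * blow k p m.-1.
Proof.
rewrite !blowE bexpS; congr (_ + _ * _); apply: eq_bexp => j /=.
by case: m => [|m] //=; rewrite !ltn0.
Qed.

(** In [blowS] a success lowers the threshold from [m] to [m - 1], so moving the mass [p' - p] from
    failure to success can only reduce the probability. *)
Lemma blow_antitone k p p' m : 0 <= p -> p <= p' -> p' <= 1 ->
  blow k p' m <= blow k p m.
Proof.
move=> p0 pp' p1; elim: k m => [|k IH] m; first by rewrite !blowE !bexp0.
have h1 := IH m; have h2 := IH m.-1.
have h3 : blow k p m.-1 <= blow k p m.
  by apply: blow_mono; rewrite ?leq_pred // p0 (le_trans pp').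
rewrite !blowS.
apply: (@le_trans _ _ ((1 - p') * blow k p m + p' * blow k p m.-1)).
  by apply: lerD; apply: ler_wpM2l => //; rewrite ?subr_ge0 // (le_trans p0).
have : 0 <= (p' - p) * (blow k p m - blow k p m.-1) by rewrite mulr_ge0 ?subr_ge0.
rewrite -subr_ge0 => h; rewrite -subr_ge0; apply: le_trans h _.
by rewrite le_eqVlt; apply/orP; left; apply/eqP; ring.
Qed.

(* With t = m - Y, the polynomial 8 t + 6 t^2 - t^4 is at most 24 for t > 0 and
   nonpositive for t <= 0 (in units of the standard deviation), while its
   expectation at the mean is at least 1. *)
Lemma blow_mean_ge k m : (0 < m)%N -> (m.*2 <= k)%N ->
  24^-1 <= blow k (m%:R / k%:R) m.
Proof.
move=> m0 mk; set p := _ / _.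
have k0 : (0 : R) < k%:R by rewrite ltr0n (leq_trans _ mk) // double_gt0.
have mR : (1 : R) <= m%:R by rewrite ler1n.
have mkR : 2 * m%:R <= k%:R :> R by rewrite -natrM ler_nat mul2n.
have kp : k%:R * p = m%:R by rewrite /p mulrC divfK // gt_eqF.
have p0 : 0 <= p by rewrite /p divr_ge0.
have p2 : p <= 1/2 by rewrite /p ler_pdivrMr //; lra.
(* [V] is the variance. It equals [m * (1 - p)], which is at least 1/2 because [m >= 1] and
   [p <= 1 / 2]. *)
pose V := k%:R * (p * (1 - p)).
have V2 : 1 / 2 <= V.
  have -> : V = m%:R * (1 - p) by rewrite /V mulrA kp.
  by nra.
pose s := Num.sqrt V.
have sV : s ^+ 2 = V by rewrite sqr_sqrtr //; lra.
have s0 : 0 < s by rewrite sqrtr_gt0; lra.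
pose h (t : R) := 8 * s ^+ 3 * t + 6 * s ^+ 2 * t ^+ 2 - t ^+ 4.
have hle j : h (m%:R - j%:R) <= (24 * s ^+ 4) * (j < m)%N%:R.
  rewrite /h; case: (ltnP j m) => jm /=; rewrite ?mulr1 ?mulr0.
    set t := (m%:R - j%:R); rewrite -subr_ge0.
    have -> : 24 * s ^+ 4 - (8 * s ^+ 3 * t + 6 * s ^+ 2 * t ^+ 2 - t ^+ 4) =
      (t ^+ 2 - 4 * s ^+ 2) ^+ 2 + 2 * s ^+ 2 * (t - 2 * s) ^+ 2 by ring.
    by rewrite addr_ge0 ?sqr_ge0 // mulr_ge0 ?sqr_ge0 // mulr_ge0 ?sqr_ge0.
  set t := (m%:R - j%:R); have t0 : 0 <= - t by rewrite oppr_ge0 subr_le0 ler_nat.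
  rewrite -subr_ge0 sub0r.
  have -> : - (8 * s ^+ 3 * t + 6 * s ^+ 2 * t ^+ 2 - t ^+ 4) =
     (- t) * ((- t - 3 / 2 * s) ^+ 2 * (- t + 3 * s) + s ^+ 2 * (3 / 4 * (- t) + 5 / 4 * s)).
    by field.
  move: t0; move: (- t) => u u0; rewrite mulr_ge0 //.
  by rewrite addr_ge0 // mulr_ge0 ?sqr_ge0 // addr_ge0 // ?mulr_ge0 //; lra.
have p01 : 0 <= p <= 1 by apply/andP; split=> //; lra.
have := le_bexp k p01 hle.
rewrite bexpZ -blowE /h.
rewrite (eq_bexp _ _ (g := fun j => (8 * s ^+ 3 * (m%:R - j%:R) + 6 * s ^+ 2 * (m%:R - j%:R) ^+ 2)
   + (-1) * (m%:R - j%:R) ^+ 4)); last by move=> j; ring.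
rewrite bexpD bexpD !bexpZ bexp_dev1 bexp_dev2 bexp_dev4 /= kp subrr -/V sV.
set D := blow _ _ _ => H.
have V4 : s ^+ 4 = V ^+ 2 by rewrite -sV; ring.
rewrite V4 in H.
have e : V * (1 + 3 * (k%:R - 2) * (p * (1 - p))) = V + 3 * V ^+ 2 - 6 * V * (p * (1 - p)).
  by rewrite /V; ring.
have q0 : 0 <= p * (1 - p) by rewrite mulr_ge0 //; lra.
(* The expectation of [h] is [3 * V ^+ 2 - V + 6 * V * (p * (1 - p))], which is at least [V ^+ 2]
   since [V >= 1 / 2]. *)
have H2 : V ^+ 2 <= 24 * V ^+ 2 * D.
  apply: le_trans H; rewrite e.
  have : 0 <= V * (p * (1 - p)) by rewrite mulr_ge0 //; lra.
  by nra.
have V20 : 0 < V ^+ 2 by rewrite exprn_gt0 //; lra.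
rewrite -(ler_pM2l V20) -(ler_pM2l (_ : 0 < 24 :> R)) //.
by rewrite mulrCA divff // mulr1 mulrA.
Qed.

(** By monotonicity in [p], the worst case is the one where the mean is exactly [m]. *)
Lemma blow_ge k p m : (0 < m)%N -> (m.*2 <= k)%N -> 0 <= p -> k%:R * p <= m%:R ->
  24^-1 <= blow k p m.
Proof.
move=> m0 mk p0 kp.
have k0 : (0 : R) < k%:R by rewrite ltr0n (leq_trans _ mk) // double_gt0.
apply: le_trans (blow_mean_ge m0 mk) _; apply: blow_antitone => //.
  by rewrite ler_pdivlMr // mulrC.
rewrite ler_pdivrMr // mul1r ler_nat (leq_trans _ mk) // -addnn leq_addr //.
Qed.

(* The Chernoff parameter [sqrt (m / (k p))] makes the exponent a perfect square. *)
Lemma blow_chernoff k p m : 0 <= p <= 1 -> (0 < m)%N -> m%:R <= k%:R * p ->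
  blow k p m <= expR (- (Num.sqrt (k%:R * p) - Num.sqrt m%:R) ^+ 2).
Proof.
move=> p01 m0 mkp.
have mR : (0 : R) < m%:R by rewrite ltr0n.
have kp0 : 0 < k%:R * p by apply: lt_le_trans mkp.
set a := Num.sqrt m%:R; set b := Num.sqrt (k%:R * p).
have a0 : 0 < a by rewrite sqrtr_gt0.
have b0 : 0 < b by rewrite sqrtr_gt0.
have ab : a <= b by rewrite ler_wsqrtr.
have a2 : a ^+ 2 = m%:R by rewrite sqr_sqrtr // ltW.
have b2 : b ^+ 2 = k%:R * p by rewrite sqr_sqrtr // ltW.
have [t te] : {t | t = a / b} by exists (a / b).
have t0 : 0 < t by rewrite te divr_gt0.
have t1 : t <= 1 by rewrite te ler_pdivrMr // mul1r.
rewrite blowE.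
(* Exponential Markov inequality: since [t <= 1], the indicator of [j < m] is at most
   [t ^ (j - m)]. *)
apply: (@le_trans _ _ (bexp k p (fun j => (t^-1) ^+ m * t ^+ j))).
  apply: le_bexp => // j; case: ltnP => jm /=; last by rewrite mulr_ge0 ?exprn_ge0 ?invr_ge0 // ltW.
  rewrite exprVn mulrC -ler_pdivrMr ?invr_gt0 ?exprn_gt0 // invrK mul1r.
  by apply: ler_wiXn2l; [exact: ltW| |exact: ltnW].
rewrite bexpZ bexp_geom.
(* Both bases are bounded by [1 + x <= exp x]. *)
apply: (@le_trans _ _ (expR (t^-1 - 1) ^+ m * expR (- (p * (1 - t))) ^+ k)).
  apply: ler_pM; rewrite ?exprn_ge0 ?invr_ge0 ?(ltW t0) //.
  - by move/andP: p01 => [p0 p1]; have := mulr_ge0 p0 (ltW t0); lra.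
  - apply: lerXn2r; rewrite ?nnegrE ?expR_ge0 ?invr_ge0 ?(ltW t0) //.
    by have := expR_ge1Dx (t^-1 - 1); lra.
  - apply: lerXn2r; rewrite ?nnegrE ?expR_ge0 //.
      by move/andP: p01 => [p0 p1]; have := mulr_ge0 p0 (ltW t0); lra.
    by have := expR_ge1Dx (- (p * (1 - t))); lra.
(* With [t = a / b] the exponent [a^2 (1 / t - 1) - b^2 (1 - t)] is exactly [- (b - a)^2]. *)
rewrite -!expRM_natl -expRD ler_expR le_eqVlt; apply/orP; left; apply/eqP.
have -> : k%:R * - (p * (1 - t)) = - b ^+ 2 * (1 - t) by rewrite b2; ring.
rewrite -a2 te; field.
by rewrite !gt_eqF.
Qed.

End Binomial.

(** * Lebesgue measure on the plane *)

Section PlaneIntegral.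
Variable R : realType.
Local Notation mu := (@lebesgue_measure R).
Local Notation lebC := (@lebC R).
Implicit Types (f g : R * R -> R).

(** Used with slope 1 for the shears and with slope [|y|] for the passage to polar coordinates. *)
Lemma ge0_integral_affine (G : R -> R) (a b : R) : 0 < a ->
  continuous G -> (forall x, 0 <= G x) ->
  (\int[mu]_x (G x)%:E = \int[mu]_x (G (a * x + b) * a)%:E)%E.
Proof.
move=> a0 cG G0.
have dF (x : R) : is_derive x 1 (fun x => a * x + b) a.
  by apply: is_derive_eq; rewrite /GRing.scale /= ; ring.
have F' : derive1 (fun x : R => a * x + b) = cst a.
  by apply/funext => x; rewrite derive1E derive_val.
rewrite (@increasing_ge0_integration_by_substitutionT _ (fun x => a * x + b)) //.
- by apply: eq_integral => x _ /=; rewrite F'.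
- by move=> x y xy; rewrite ltrD2r ltr_pM2l.
- by rewrite F'; exact: cst_continuous.
- by rewrite F'; exact: is_cvg_cst.
- by rewrite F'; exact: is_cvg_cst.
- apply/cvgrNyPle => A; near=> x.
  rewrite -lerBrDr mulrC -ler_pdivlMr //; near: x; exact: nbhs_ninfty_le.
- apply/cvgryPge => A; near=> x.
  rewrite -lerBlDr mulrC -ler_pdivrMr //; near: x; exact: nbhs_pinfty_ge.
Unshelve. all: by end_near. Qed.

(** Measurability serves Tonelli's theorem; continuity passes to the slices, where the
    one-dimensional substitution rule requires it. *)
Definition tame f := measurable_fun setT f /\ continuous f.

Lemma tame_fst : tame fst.
Proof. by split; [exact: measurable_fst | move=> x; exact: cvg_fst]. Qed.
Lemma tame_snd : tame snd.
Proof. by split; [exact: measurable_snd | move=> x; exact: cvg_snd]. Qed.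
Lemma tame_cst (c : R) : tame (cst c).
Proof. by split; [exact: measurable_cst | exact: cst_continuous]. Qed.
Lemma tameD f g : tame f -> tame g -> tame (fun x => f x + g x).
Proof.
move=> [mf cf] [mg cg]; split; first exact: measurable_funD.
by move=> x; apply: cvgD; [exact: cf | exact: cg].
Qed.
Lemma tameM f g : tame f -> tame g -> tame (fun x => f x * g x).
Proof.
move=> [mf cf] [mg cg]; split; first exact: measurable_funM.
by move=> x; apply: cvgM; [exact: cf | exact: cg].
Qed.
Lemma tame_comp (h : R -> R) f : continuous h -> tame f -> tame (fun x => h (f x)).
Proof.
move=> ch [mf cf]; split.
  by apply: (measurableT_comp (f := h)) => //; exact: continuous_measurable_fun.
by move=> x; apply: (continuous_comp (f := f) (g := h)); [exact: cf | exact: ch].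
Qed.
Lemma tame_pair f g h : tame f -> tame g -> tame h -> tame (fun x => f (g x, h x)).
Proof.
move=> [mf cf] [mg cg] [mh ch]; split.
  apply: (measurableT_comp (f := f) (g := fun x => (g x, h x))) => //.
  exact: measurable_fun_pair.
move=> x; apply: (continuous_comp (f := fun x => (g x, h x)) (g := f)).
  exact: (cvg_pair (cg x) (ch x)).
exact: cf.
Qed.

Lemma tame_slicel f x : tame f -> continuous (fun y => f (x, y)).
Proof.
move=> [_ cf] y; apply: (continuous_comp (f := fun y => (x, y)) (g := f)).
  by apply: (cvg_pair (F := nbhs y) (G := nbhs x) (H := nbhs y)); [exact: cvg_cst | exact: cvg_id].
exact: cf.
Qed.
Lemma tame_slicer f y : tame f -> continuous (fun x => f (x, y)).
Proof.
move=> [_ cf] x; apply: (continuous_comp (f := fun x => (x, y)) (g := f)).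
  by apply: (cvg_pair (F := nbhs x) (G := nbhs x) (H := nbhs y)); [exact: cvg_id | exact: cvg_cst].
exact: cf.
Qed.

Lemma ge0_tonelli12 f : tame f -> (forall x, 0 <= f x) ->
  (\int[lebC]_z (f z)%:E = \int[mu]_x \int[mu]_y (f (x, y))%:E)%E.
Proof.
move=> [mf _] f0; apply: (fubini_tonelli1 (m1 := mu) (m2 := mu) (EFin \o f)).
- exact/measurable_EFinP.
- by move=> x; rewrite lee_fin.
Qed.
Lemma ge0_tonelli21 f : tame f -> (forall x, 0 <= f x) ->
  (\int[lebC]_z (f z)%:E = \int[mu]_y \int[mu]_x (f (x, y))%:E)%E.
Proof.
move=> [mf _] f0; apply: (fubini_tonelli2 (m1 := mu) (m2 := mu) (EFin \o f)).
- exact/measurable_EFinP.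
- by move=> x; rewrite lee_fin.
Qed.

(** On each line [y] constant the shear is the translation by [t * y], and Tonelli allows
    integrating along these lines first. *)
Lemma ge0_shear1 f (t : R) : tame f -> (forall x, 0 <= f x) ->
  (\int[lebC]_z (f z)%:E = \int[lebC]_z (f ((z.1 + t * z.2)%R, z.2))%:E)%E.
Proof.
move=> tf f0; rewrite ge0_tonelli21 // ge0_tonelli21; last first.
- by move=> x.
- apply: tame_pair => //; last exact: tame_snd.
  by apply: tameD; [|apply: tameM]; [exact: tame_fst|exact: tame_cst|exact: tame_snd].
apply: eq_integral => y _ /=.
rewrite (@ge0_integral_affine (fun x => f (x, y)) 1 (t * y)) //; last exact: tame_slicer.
by apply: eq_integral => x _ ; rewrite mulr1 mul1r.
Qed.
Lemma ge0_shear2 f (t : R) : tame f -> (forall x, 0 <= f x) ->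
  (\int[lebC]_z (f z)%:E = \int[lebC]_z (f (z.1, (z.2 + t * z.1)%R))%:E)%E.
Proof.
move=> tf f0; rewrite ge0_tonelli12 // ge0_tonelli12; last first.
- by move=> x.
- apply: tame_pair => //; first exact: tame_fst.
  by apply: tameD; [|apply: tameM]; [exact: tame_snd|exact: tame_cst|exact: tame_fst].
apply: eq_integral => y _ /=.
rewrite (@ge0_integral_affine (fun x => f (y, x)) 1 (t * y)) //; last exact: tame_slicel.
by apply: eq_integral => x _ ; rewrite mulr1 mul1r.
Qed.

(** Multiplication by [(3 + 4i) / 5]. This number has modulus one and is not a root of unity, so
    this single rotation suffices to separate all frequencies. *)
Definition rot345 (z : R * R) : R * R :=
  ((3 * z.1 - 4 * z.2) / 5, (4 * z.1 + 3 * z.2) / 5).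

Let tame_aff (a b : R) : tame (fun z => a * z.1 + b * z.2).
Proof.
by apply: tameD; apply: tameM; [exact: tame_cst|exact: tame_fst|exact: tame_cst|exact: tame_snd].
Qed.

(* A rotation is a product of three shears, and each shear preserves the
   measure by Tonelli and translation invariance. *)
Lemma ge0_rot f : tame f -> (forall x, 0 <= f x) ->
  (\int[lebC]_z (f (rot345 z))%:E = \int[lebC]_z (f z)%:E)%E.
Proof.
move=> tf f0.
(* For the angle [theta] with sine 4/5 and cosine 3/5, the shear coefficients are
   [- tan (theta / 2) = - 1 / 2], [sin theta = 4 / 5] and again [- 1 / 2]. *)
pose s1 (g : R * R -> R) := fun z : R * R => g ((z.1 + - (1 / 2) * z.2)%R, z.2).
pose s2 (g : R * R -> R) := fun z : R * R => g (z.1, (z.2 + 4 / 5 * z.1)%R).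
have t1 g : tame g -> tame (s1 g).
  move=> tg; apply: tame_pair => //; last exact: tame_snd.
  by apply: tameD; [|apply: tameM]; [exact: tame_fst|exact: tame_cst|exact: tame_snd].
have t2 g : tame g -> tame (s2 g).
  move=> tg; apply: tame_pair => //; first exact: tame_fst.
  by apply: tameD; [|apply: tameM]; [exact: tame_snd|exact: tame_cst|exact: tame_fst].
rewrite (@ge0_shear1 f (- (1 / 2))) //.
rewrite (@ge0_shear2 (s1 f) (4 / 5)) //; [|exact: t1|by move=> z; exact: f0].
rewrite (@ge0_shear1 (s2 (s1 f)) (- (1 / 2))) //; [|exact/t2/t1|by move=> z; exact: f0].
apply: eq_integral => z _; rewrite /s1 /s2 /=; congr (f (_, _))%:E.
  by field.
by field.
Qed.

(** The nonnegative case applies to the positive and negative parts, which are again tame. *)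
Lemma integral_rot f : tame f ->
  (\int[lebC]_z (f (rot345 z))%:E = \int[lebC]_z (f z)%:E)%E.
Proof.
move=> tf.
have tp : tame f^\+.
  apply: (tame_comp (h := fun t : R => Num.max t 0)) => //.
  by move=> x; apply: continuous_max; [exact: cvg_id|exact: cvg_cst].
have tn : tame f^\-.
  apply: (tame_comp (h := fun t : R => Num.max (- t) 0)) => //.
  by move=> x; apply: continuous_max; [apply: continuousN; exact: cvg_id|exact: cvg_cst].
rewrite integralE [RHS]integralE; congr (_ - _)%E.
- transitivity (\int[lebC]_z (f^\+ z)%:E)%E.
    rewrite -[RHS]ge0_rot //.
    by apply: eq_integral => z _; rewrite funeposE /funrpos EFin_max.
  by apply: eq_integral => z _; rewrite funeposE /funrpos EFin_max.
- transitivity (\int[lebC]_z (f^\- z)%:E)%E.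
    rewrite -[RHS]ge0_rot //.
    by apply: eq_integral => z _; rewrite funenegE /funrneg EFin_max.
  by apply: eq_integral => z _; rewrite funenegE /funrneg EFin_max.
Qed.

End PlaneIntegral.

(** * Integrals of powers of [1 / (1 + |z|^2)] over the plane *)

Section Radial.
Variable R : realType.
Local Notation mu := (@lebesgue_measure R).
Local Notation lebC := (@lebC R).

Lemma integralT_oneDsqrV : (\int[mu]_x ((1 + x ^+ 2)^-1)%:E = (pi : R)%:E)%E.
Proof.
rewrite ge0_symfun_integralT.
- rewrite (_ : [set x | (0 <= x)%R] = `[0%R, +oo[%classic); last first.
    by apply/seteqP; split => x /=; rewrite in_itv /= andbT.
  rewrite (integral0y_oneDsqr R) -EFinM; congr _%:E; by field.
- by move=> x; rewrite invr_ge0 addr_ge0 // sqr_ge0.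
- exact: continuous_oneDsqrV.
- by move=> x; rewrite /= sqrrN.
Qed.

Lemma continuous_oneDcsqrV (c : R) : 0 <= c -> continuous (fun y : R => (1 + c * y ^+ 2)^-1).
Proof.
move=> c0 y; apply: (@continuousV _ _ (fun y : R => 1 + c * y ^+ 2)).
  by rewrite gt_eqF // ltr_pwDl // mulr_ge0 // sqr_ge0.
apply: cvgD; first exact: cvg_cst.
by apply: cvgM; [exact: cvg_cst | exact: exprn_continuous].
Qed.

(** The factor [|y|], a Jacobian in the later use, makes the integrand an exact derivative on the
    half-line. With [c = 1 + u ^+ 2] the result is a multiple of the Cauchy density in [u]. *)
Lemma integral_radial_slice (c : R) n : 0 < c ->
  (\int[mu]_y (`|y| * (1 + c * y ^+ 2)^-1 ^+ n.+2)%:E = ((n.+1%:R * c)^-1)%:E)%E.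
Proof.
move=> c0.
have pos y : 0 < 1 + c * y ^+ 2 by rewrite ltr_pwDl // mulr_ge0 ?sqr_ge0 // ltW.
have cV := continuous_oneDcsqrV (ltW c0).
have cVn k : continuous (fun y : R => (1 + c * y ^+ 2)^-1 ^+ k).
  move=> y; apply: (continuous_comp (f := fun y : R => (1 + c * y ^+ 2)^-1) (g := fun x : R => x ^+ k)).
    exact: cV.
  exact: exprn_continuous.
rewrite ge0_symfun_integralT; last 3 first.
- by move=> y; rewrite mulr_ge0 // exprn_ge0 // invr_ge0 ltW.
- by move=> y; apply: continuousM; [exact: norm_continuous | exact: cVn].
- by move=> y /=; rewrite normrN sqrrN.
rewrite (_ : [set x | (0 <= x)%R] = `[0%R, +oo[%classic); last first.
  by apply/seteqP; split => x /=; rewrite in_itv /= andbT.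
under eq_integral => y.
  rewrite inE /= in_itv /= andbT => y0; rewrite (ger0_norm y0); over.
(* [F] is the antiderivative that vanishes at infinity, so the half-line contributes [- F 0], which
   is then doubled by symmetry. *)
pose K : R := - (2 * c * n.+1%:R)^-1.
pose F (y : R) := K * (1 + c * y ^+ 2)^-1 ^+ n.+1.
have dF (y : R) : is_derive y 1 F (y * (1 + c * y ^+ 2)^-1 ^+ n.+2).
  have h := pos y.
  have h1 : is_derive y 1 (fun y : R => 1 + c * y ^+ 2) (c * (2 * y)).
    apply: is_derive_eq; rewrite add0r mul1r.
    by change (c * (y * 1 + y * 1) = c * (2 * y)); ring.
  have h2 : is_derive y 1 (fun y : R => (1 + c * y ^+ 2)^-1)
      (- (1 + c * y ^+ 2) ^- 2 *: (c * (2 * y))).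
    by apply: is_deriveV; rewrite gt_eqF.
  have h3 : is_derive y 1 (fun y : R => (1 + c * y ^+ 2)^-1 ^+ n.+1)
      ((n.+1%:R * (1 + c * y ^+ 2)^-1 ^+ n) *: (- (1 + c * y ^+ 2) ^- 2 *: (c * (2 * y)))).
    by have := is_deriveX n.+1 h2; rewrite exprfctE.
  have h4 := is_deriveZ K h3.
  apply: is_derive_eq.
  change (K * ((n.+1%:R * (1 + c * y ^+ 2)^-1 ^+ n) * (- (1 + c * y ^+ 2) ^- 2 * (c * (2 * y))))
    = y * (1 + c * y ^+ 2)^-1 ^+ n.+2).
  have : n.+1%:R != 0 :> R by rewrite pnatr_eq0.
  rewrite /K; move: (1 + c * y ^+ 2) h => t t0; move: n.+1%:R => N N0.
  rewrite !exprS; move: (t^-1 ^+ n) => T.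
  by field; rewrite N0 !gt_eqF.
rewrite (@ge0_continuous_FTC2y _ _ F 0 0).
- rewrite -EFinB -EFinM; congr _%:E; rewrite /F expr0n /= mulr0 addr0 invr1 expr1n /K.
  by field; rewrite !gt_eqF // ltr0n.
- by move=> y y0; rewrite mulr_ge0 // exprn_ge0 // invr_ge0 ltW.
- apply: continuous_subspaceT => y; apply: cvgM; [exact: cvg_id | exact: cVn].
- have hV : (fun y : R => (1 + c * y ^+ 2)^-1) y @[y --> +oo%R] --> (0 : R).
    apply/(@gtr0_cvgV0 _ _ _ _ (fun y : R => 1 + c * y ^+ 2)).
      by near=> y; exact: pos.
    apply/cvgryPge => A; near=> y.
  have y1 : 1 <= y by near: y; apply: nbhs_pinfty_ge; rewrite num_real.
  have yA : A / c <= y by near: y; apply: nbhs_pinfty_ge; rewrite num_real.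
  have : A <= c * y by rewrite mulrC -ler_pdivrMr.
  have : c * y <= c * y ^+ 2 by rewrite ler_pM2l // expr2 ler_peMr // (le_trans ler01).
    by lra.
  rewrite /F -[X in _ --> X](mulr0 K); apply: cvgM; first exact: cvg_cst.
  elim: (n) => [|k IH]; first by under eq_fun do rewrite expr1; exact: hV.
  have h := cvgM hV IH; rewrite mulr0 in h.
  by under eq_fun do rewrite exprS; exact: h.
- by move=> y _; exact: ex_derive.
- apply: cvg_at_right_filter; apply: differentiable_continuous; apply/derivable1_diffP.
  exact: ex_derive.
- by move=> y _; rewrite derive1E derive_val.
Unshelve. all: by end_near. Qed.

Definition rad (z : R * R) : R := (1 + (z.1 ^+ 2 + z.2 ^+ 2))^-1.

Lemma rad_gt0 z : 0 < rad z.
Proof. by rewrite invr_gt0 ltr_pwDl // addr_ge0 // sqr_ge0. Qed.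

Lemma tame_norm : tame (fun z : R * R => z.1 ^+ 2 + z.2 ^+ 2).
Proof.
by apply: tameD; apply: (tame_comp (h := fun x : R => x ^+ 2));
  [exact: exprn_continuous | exact: tame_fst | exact: exprn_continuous | exact: tame_snd].
Qed.

Lemma tame_oneDnormV (f : R * R -> R) : tame f -> (forall z, 0 <= f z) ->
  tame (fun z => (1 + f z)^-1).
Proof.
move=> tf f0; rewrite (_ : (fun z => _) = (fun z => (fun t : R => (1 + `|t|)^-1) (f z))).
  apply: (tame_comp (h := fun t : R => (1 + `|t|)^-1)) => // t; apply: (@continuousV _ _ (fun t : R => 1 + `|t|)).
    by rewrite gt_eqF // ltr_pwDl.
  by apply: cvgD; [exact: cvg_cst | exact: norm_continuous].
by apply/funext => z; rewrite ger0_norm.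
Qed.

Lemma tame_rad : tame rad.
Proof. by apply: (tame_oneDnormV tame_norm) => z; rewrite addr_ge0 // sqr_ge0. Qed.

Lemma tameX (f : R * R -> R) n : tame f -> tame (fun z => f z ^+ n).
Proof. by apply: (tame_comp (h := fun x : R => x ^+ n)); exact: exprn_continuous. Qed.

(* Polar coordinates in disguise: substitute x = |y| u and swap the integrals. *)
Lemma integral_rad n : (\int[lebC]_z (rad z ^+ n.+2)%:E = (pi / n.+1%:R : R)%:E)%E.
Proof.
have rn0 z : 0 <= rad z ^+ n.+2 by rewrite exprn_ge0 // ltW // rad_gt0.
have tr : tame (fun z => rad z ^+ n.+2) by apply: tameX; exact: tame_rad.
pose kf (z : R * R) : R := `|z.2| * (1 + (1 + z.1 ^+ 2) * z.2 ^+ 2)^-1 ^+ n.+2.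
have k0 z : 0 <= kf z.
  rewrite mulr_ge0 // exprn_ge0 // invr_ge0 ltW // ltr_pwDl // mulr_ge0 ?sqr_ge0 //.
  by rewrite addr_ge0 // sqr_ge0.
have tk : tame kf.
  apply: tameM.
    by apply: (tame_comp (h := fun x : R => `|x|)); [exact: norm_continuous|exact: tame_snd].
  apply: tameX; apply: tame_oneDnormV; last first.
    by move=> z; rewrite mulr_ge0 ?sqr_ge0 // addr_ge0 // sqr_ge0.
  apply: tameM; last by apply: tameX; exact: tame_snd.
  by apply: tameD; [exact: tame_cst | apply: tameX; exact: tame_fst].
transitivity (\int[lebC]_z (kf z)%:E)%E.
  rewrite (ge0_tonelli21 tr rn0) (ge0_tonelli21 tk k0).
  have m1 : measurable_fun setT (fun y => \int[mu]_x (rad (x, y) ^+ n.+2)%:E)%E.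
    apply: (measurable_fun_fubini_tonelli_G (m1 := mu) (fun z => (rad z ^+ n.+2)%:E)).
      by apply/measurable_EFinP; case: tr.
    by move=> z; rewrite lee_fin.
  have m2 : measurable_fun setT (fun y => \int[mu]_x (kf (x, y))%:E)%E.
    apply: (measurable_fun_fubini_tonelli_G (m1 := mu) (fun z => (kf z)%:E)).
      by apply/measurable_EFinP; case: tk.
    by move=> z; rewrite lee_fin.
  (* The scaling by [|y|] degenerates at [y = 0], so this point is removed from both outer
     integrals. *)
  rewrite -(@integral_setD1 _ _ 0); last 2 first.
    by apply: measurableD => //; exact: measurable_set1.
    exact: measurable_funTS.
  rewrite -[RHS](@integral_setD1 _ _ 0); last 2 first.
    by apply: measurableD => //; exact: measurable_set1.
    exact: measurable_funTS.
  apply: eq_integral => y; rewrite inE /= => -[_ /eqP y0].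
  have ay : 0 < `|y| by rewrite normr_gt0.
  rewrite (@ge0_integral_affine _ (fun x => rad (x, y) ^+ n.+2) `|y| 0) //.
    apply: eq_integral => x _; congr _%:E; rewrite /kf /rad /= addr0 mulrC; congr (_ * _^-1 ^+ _).
    by rewrite exprMn real_normK ?num_real //; ring.
  exact: (tame_slicer (f := fun z => rad z ^+ n.+2) (y := y) tr).
rewrite (ge0_tonelli12 tk k0).
under eq_integral => x _.
  rewrite /kf /= integral_radial_slice; last by rewrite ltr_pwDl // sqr_ge0.
  rewrite invfM EFinM; over.
rewrite ge0_integralZl //.
- by rewrite integralT_oneDsqrV -EFinM mulrC.
- by apply/measurable_EFinP; exact: (continuous_measurable_fun (@continuous_oneDsqrV R)).
- by move=> x _; rewrite lee_fin invr_ge0 addr_ge0 // sqr_ge0.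
Qed.

End Radial.

(** * Real and imaginary parts, modulus and conjugation *)

Section ComplexBasics.
Variable R : realType.
Local Notation C := R[i].
Local Notation Re := complex.Re.
Local Notation Im := complex.Im.
Local Notation normc := (@ComplexField.Normc.normc R).
Implicit Types (u v : C).

Lemma cReD u v : Re (u + v) = Re u + Re v. Proof. by case: u v => [? ?] [? ?]. Qed.
Lemma cImD u v : Im (u + v) = Im u + Im v. Proof. by case: u v => [? ?] [? ?]. Qed.
Lemma cReM u v : Re (u * v) = Re u * Re v - Im u * Im v.
Proof. by case: u v => [? ?] [? ?]. Qed.
Lemma cImM u v : Im (u * v) = Re u * Im v + Im u * Re v.
Proof. by case: u v => [? ?] [? ?]. Qed.
Lemma cRe_conj u : Re (conjc u) = Re u. Proof. by case: u. Qed.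
Lemma cIm_conj u : Im (conjc u) = - Im u. Proof. by case: u. Qed.
Lemma complex_eq u v : Re u = Re v -> Im u = Im v -> u = v.
Proof. by case: u v => [? ?] [? ?] /= -> ->. Qed.

Lemma normc_sqr u : normc u ^+ 2 = Re u ^+ 2 + Im u ^+ 2.
Proof. by case: u => a b /=; rewrite sqr_sqrtr // addr_ge0 // sqr_ge0. Qed.
Lemma normc_ge0 u : 0 <= normc u.
Proof. by case: u => a b /=; exact: sqrtr_ge0. Qed.
Lemma normcX u n : normc (u ^+ n) = normc u ^+ n.
Proof.
elim: n => [|n IH]; first by rewrite !expr0 ComplexField.Normc.normc1.
by rewrite !exprS ComplexField.Normc.normcM IH.
Qed.
Lemma normc_conj u : normc (conjc u) = normc u.
Proof. by case: u => a b /=; rewrite sqrrN. Qed.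
Lemma mulcJ u : u * conjc u = (normc u ^+ 2)%:C%C.
Proof.
apply: complex_eq; rewrite ?cReM ?cImM cRe_conj cIm_conj ?normc_sqr /=; ring.
Qed.
Lemma normc_real (x : R) : normc (x%:C)%C = `|x|.
Proof. by rewrite /= expr0n addr0 sqrtr_sqr. Qed.
Lemma Re_le_normc u : `|Re u| <= normc u.
Proof. by case: u => a b /=; rewrite -sqrtr_sqr ler_wsqrtr // lerDl sqr_ge0. Qed.
Lemma Im_le_normc u : `|Im u| <= normc u.
Proof. by case: u => a b /=; rewrite -sqrtr_sqr ler_wsqrtr // lerDr sqr_ge0. Qed.

End ComplexBasics.

(** * Integration of complex-valued functions on the plane *)

Section ComplexIntegral.
Variable R : realType.
Local Notation C := R[i].
Local Notation Re := complex.Re.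
Local Notation Im := complex.Im.
Local Notation normc := (@ComplexField.Normc.normc R).
Local Notation lebC := (@lebC R).
Implicit Types (h g : R * R -> C) (c : C).

Definition cint h : C := Complex (\int[lebC]_z Re (h z)) (\int[lebC]_z Im (h z)).

Definition cintegrable h :=
  lebC.-integrable setT (fun z => (Re (h z))%:E) /\
  lebC.-integrable setT (fun z => (Im (h z))%:E).

Lemma cintegrableD h g : cintegrable h -> cintegrable g ->
  cintegrable (fun z => h z + g z).
Proof.
move=> [h1 h2] [g1 g2]; split.
  have := integrableD measurableT h1 g1.
  by apply: eq_integrable => // z _ /=; rewrite cReD EFinD.
have := integrableD measurableT h2 g2.
by apply: eq_integrable => // z _ /=; rewrite cImD EFinD.
Qed.

Lemma cintD h g : cintegrable h -> cintegrable g ->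
  cint (fun z => h z + g z) = cint h + cint g.
Proof.
move=> [h1 h2] [g1 g2]; apply: complex_eq; rewrite ?cReD ?cImD /=.
  by rewrite -RintegralD //; apply: eq_Rintegral => z _; rewrite cReD.
by rewrite -RintegralD //; apply: eq_Rintegral => z _; rewrite cImD.
Qed.

Lemma cintegrableZ c h : cintegrable h -> cintegrable (fun z => c * h z).
Proof.
move=> [h1 h2]; split.
  have := integrableD measurableT (integrableZl measurableT (Re c) h1)
    (integrableZl measurableT (- Im c) h2).
  by apply: eq_integrable => // z _ /=; rewrite -!EFinM -EFinD cReM mulNr.
have := integrableD measurableT (integrableZl measurableT (Re c) h2)
  (integrableZl measurableT (Im c) h1).
by apply: eq_integrable => // z _ /=; rewrite -!EFinM -EFinD cImM.
Qed.

Lemma cintZ c h : cintegrable h -> cint (fun z => c * h z) = c * cint h.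
Proof.
have L a b (f1 f2 : R * R -> R) : lebC.-integrable setT (fun z => (f1 z)%:E) ->
    lebC.-integrable setT (fun z => (f2 z)%:E) ->
    \int[lebC]_z (a * f1 z + b * f2 z) = a * (\int[lebC]_z f1 z) + b * (\int[lebC]_z f2 z).
  move=> i1 i2; rewrite -!RintegralZl // RintegralD //.
    have := integrableZl measurableT a i1.
    by apply: eq_integrable => // z _ /=; rewrite EFinM.
  have := integrableZl measurableT b i2.
  by apply: eq_integrable => // z _ /=; rewrite EFinM.
move=> [h1 h2]; apply: complex_eq; rewrite ?cReM ?cImM /=.
  by rewrite -mulNr -L //; apply: eq_Rintegral => z _; rewrite cReM mulNr.
by rewrite -L //; apply: eq_Rintegral => z _; rewrite cImM.
Qed.

Lemma cintegrable0 : cintegrable (fun=> 0).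
Proof. by split; exact: integrable0. Qed.

Lemma cint_sum (I : Type) (s : seq I) (h : I -> R * R -> C) :
  (forall i, cintegrable (h i)) ->
  cintegrable (fun z => \sum_(i <- s) h i z) /\
  cint (fun z => \sum_(i <- s) h i z) = \sum_(i <- s) cint (h i).
Proof.
move=> ih; elim: s => [|i s [I1 I2]].
  rewrite (_ : (fun z => _) = fun=> 0); last by apply/funext => z; rewrite big_nil.
  rewrite big_nil; split; first exact: cintegrable0.
  by apply: complex_eq; rewrite /= /Rintegral integral0.
rewrite (_ : (fun z => _) = fun z => h i z + \sum_(j <- s) h j z); last first.
  by apply/funext => z; rewrite big_cons.
by split; [exact: cintegrableD | rewrite cintD // I2 big_cons].
Qed.

Definition tameC h := tame (fun z => Re (h z)) /\ tame (fun z => Im (h z)).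

Lemma tameC_cst c : tameC (fun=> c). Proof. by split; exact: tame_cst. Qed.
Lemma tameC_cpt : tameC (@cpt R). Proof. by split; [exact: tame_fst | exact: tame_snd]. Qed.
Lemma tameC_real (f : R * R -> R) : tame f -> tameC (fun z => (f z)%:C%C).
Proof. by move=> tf; split => //; exact: tame_cst. Qed.
Lemma tameN (f : R * R -> R) : tame f -> tame (fun z => - f z).
Proof.
move=> tf; rewrite (_ : (fun z => _) = fun z => (-1) * f z).
  by apply: tameM => //; exact: tame_cst.
by apply/funext => z; rewrite mulN1r.
Qed.
Lemma tameC_conj h : tameC h -> tameC (fun z => conjc (h z)).
Proof.
move=> [h1 h2]; split.
  by rewrite (_ : (fun z => _) = fun z => Re (h z)) //; apply/funext => z; rewrite cRe_conj.
rewrite (_ : (fun z => _) = fun z => - Im (h z)); last by apply/funext => z; rewrite cIm_conj.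
exact: tameN.
Qed.
Lemma tameCM h g : tameC h -> tameC g -> tameC (fun z => h z * g z).
Proof.
move=> [h1 h2] [g1 g2]; split.
  rewrite (_ : (fun z => _) = fun z => Re (h z) * Re (g z) + - (Im (h z) * Im (g z))).
    by apply: tameD; [exact: tameM | apply: tameN; exact: tameM].
  by apply/funext => z; rewrite cReM.
rewrite (_ : (fun z => _) = fun z => Re (h z) * Im (g z) + (Im (h z) * Re (g z))).
  by apply: tameD; exact: tameM.
by apply/funext => z; rewrite cImM.
Qed.
Lemma tameCX h n : tameC h -> tameC (fun z => h z ^+ n).
Proof.
move=> th; elim: n => [|n IH].
  by under eq_fun do rewrite expr0; exact: tameC_cst.
by under eq_fun do rewrite exprS; exact: tameCM.
Qed.

(** The dominating function has integral [pi], by [integral_rad] with [n = 0]. *)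
Lemma cintegrable_dom h : tameC h -> (forall z, normc (h z) <= rad z ^+ 2) -> cintegrable h.
Proof.
have ir : lebC.-integrable setT (fun z => (rad z ^+ 2)%:E).
  apply/integrableP; split.
    by apply/measurable_EFinP; case: (tameX 2 (tame_rad R)).
  under eq_integral => z _ do rewrite gee0_abs ?lee_fin ?exprn_ge0 ?(ltW (rad_gt0 z)) //.
  by rewrite (integral_rad R 0) ltry.
move=> [t1 t2] b; split.
- apply: (le_integrable measurableT _ _ ir); first by apply/measurable_EFinP; case: t1.
  move=> z _ /=; rewrite lee_fin (ger0_norm (exprn_ge0 2 (ltW (rad_gt0 z)))).
  exact: le_trans (Re_le_normc _) (b z).
- apply: (le_integrable measurableT _ _ ir); first by apply/measurable_EFinP; case: t2.
  move=> z _ /=; rewrite lee_fin (ger0_norm (exprn_ge0 2 (ltW (rad_gt0 z)))).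
  exact: le_trans (Im_le_normc _) (b z).
Qed.

Lemma cint_rot h : tameC h -> cint (fun z => h (rot345 z)) = cint h.
Proof.
move=> [t1 t2]; apply: complex_eq => /=.
  by rewrite /Rintegral (integral_rot t1).
by rewrite /Rintegral (integral_rot t2).
Qed.

Lemma wtE k (z : R * R) : wt k (cpt z) = pi^-1 * rad z ^+ k.+2.
Proof.
rewrite /wt normc_sqr /= /rad exprVn -!invfM; congr _^-1.
by rewrite -mulrA -exprD.
Qed.

(** * Orthogonality and norms of the monomials *)

Definition cmono a b k (z : R * R) : C :=
  cpt z ^+ a * conjc (cpt z) ^+ b * (wt k (cpt z))%:C%C.

Lemma tameC_wt k : tameC (fun z => (wt k (cpt z))%:C%C).
Proof.
apply: tameC_real; rewrite (_ : (fun z => _) = fun z => pi^-1 * rad z ^+ k.+2).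
  by apply: tameM; [exact: tame_cst | apply: tameX; exact: tame_rad].
by apply/funext => z; rewrite wtE.
Qed.

Lemma tameC_cmono a b k : tameC (cmono a b k).
Proof.
apply: tameCM; last exact: tameC_wt.
by apply: tameCM; apply: tameCX; [|apply: tameC_conj]; exact: tameC_cpt.
Qed.

(** Since [|z|^(a + b) <= (1 + |z|^2)^k], the weight still leaves the integrable factor
    [rad z ^+ 2]. *)
Lemma cintegrable_cmono a b k : (a <= k)%N -> (b <= k)%N -> cintegrable (cmono a b k).
Proof.
move=> ak bk; apply: cintegrable_dom; first exact: tameC_cmono.
move=> z; rewrite /cmono !ComplexField.Normc.normcM !normcX normc_conj normc_real.
rewrite wtE; set n := normc (cpt z).
have n0 : 0 <= n by exact: normc_ge0.
have nE : rad z = (1 + n ^+ 2)^-1 by rewrite /n normc_sqr.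
have s1 : 1 <= 1 + n ^+ 2 by rewrite lerDl sqr_ge0.
have s0 : 0 < 1 + n ^+ 2 by rewrite (lt_le_trans _ s1).
rewrite ger0_norm; last by rewrite mulr_ge0 ?invr_ge0 ?pi_ge0 // exprn_ge0 // ltW // rad_gt0.
(* Comparing with powers of the square root [s] also covers odd [a + b]. *)
pose s := Num.sqrt (1 + n ^+ 2).
have sE : s ^+ 2 = 1 + n ^+ 2 by rewrite sqr_sqrtr // ltW.
have ns : n <= s.
  by rewrite -(ler_pXn2r (_ : 0 < 2)%N) ?nnegrE ?sqrtr_ge0 // sE lerDr.
have s11 : 1 <= s by rewrite -(ler_pXn2r (_ : 0 < 2)%N) ?nnegrE ?sqrtr_ge0 // sE expr1n.
have H : n ^+ a * n ^+ b <= (1 + n ^+ 2) ^+ k.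
  rewrite -sE -exprM -exprD; apply: (@le_trans _ _ (s ^+ (a + b))).
    by apply: lerXn2r => //; rewrite nnegrE sqrtr_ge0.
  by apply: ler_weXn2l => //; rewrite mul2n -addnn leq_add.
have pi1 : (pi : R)^-1 <= 1.
  by rewrite invf_le1 ?pi_gt0 // (le_trans _ (pi_ge2 R)) // ler1n.
have -> : rad z ^+ 2 = (1 + n ^+ 2) ^+ k * (1 * rad z ^+ k.+2).
  by rewrite nE mul1r -[k.+2]addn2 exprD mulrA -exprMn divff ?expr1n ?mul1r // gt_eqF.
apply: ler_pM => //.
- by rewrite mulr_ge0 // exprn_ge0.
- by rewrite mulr_ge0 ?invr_ge0 ?pi_ge0 // exprn_ge0 // ltW // rad_gt0.
- by rewrite ler_wpM2r // exprn_ge0 // ltW // rad_gt0.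
Qed.

Definition zeta : C := Complex (3 / 5) (4 / 5).

Lemma zetaJ : zeta * conjc zeta = 1.
Proof. by apply: complex_eq => /=; field. Qed.

(* (3 + 4i)^n is congruent to 3 + 4i modulo 5, hence never real. *)
Lemma zetaX_neq1 n : (0 < n)%N -> zeta ^+ n != 1.
Proof.
move=> n0; have [A [B E]] : exists A B : int,
    (5 * zeta) ^+ n = Complex (5 * A%:~R + 3) (5 * B%:~R + 4).
  case: n n0 => // n _; elim: n => [|n [A [B IH]]].
    by exists 0, 0; rewrite expr1; apply: complex_eq => /=; field.
  exists (3 * A - 4 * B - 2), (4 * A + 3 * B + 4).
  rewrite exprS IH !(intrD, intrM, rmorphN, rmorphB, rmorphD, rmorphM) /=.
  by apply: complex_eq => /=; field.
apply/eqP => z1; move: E; rewrite exprMn z1 mulr1 => E.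
have : 5 * B%:~R + 4 = 0 :> R.
  have := congr1 (fun u : C => Im u) E; rewrite /= => <-.
  by elim: (n) => [|m IH] //; rewrite exprS cImM IH /=; ring.
rewrite -[5]/(5%:~R) -[4]/(4%:~R) -intrM -intrD => /eqP; rewrite intr_eq0 => /eqP h.
by lia.
Qed.

(** Rotation invariance multiplies the integral by [zeta ^ (a - b)], which differs from 1, so the
    integral vanishes. *)
Lemma cint_cmono_off a b k : (a <= k)%N -> (b <= k)%N -> a != b ->
  cint (cmono a b k) = 0.
Proof.
move=> ak bk ab.
have radr z : rad (rot345 z) = rad z :> R by rewrite /rad /rot345 /=; congr _^-1; field.
have cr z : cpt (rot345 z) = zeta * cpt z.
  by apply: complex_eq; rewrite /rot345 /=; field.
have E : zeta ^+ a * conjc zeta ^+ b * cint (cmono a b k) = cint (cmono a b k).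
  rewrite -[RHS](cint_rot (tameC_cmono a b k)) -cintZ; last exact: cintegrable_cmono.
  congr cint; apply/funext => z.
  by rewrite /cmono !wtE radr cr (rmorphM conjc) !exprMn; ring.
have zn : zeta ^+ a * conjc zeta ^+ b != 1.
  have [|ba] := ltnP a b => [/ltnW lab|].
    rewrite -(subnKC lab) exprD mulrA -exprMn zetaJ expr1n mul1r.
    rewrite -rmorphXn -(inj_eq (can_inj (@conjcK R))) rmorph1 conjcK zetaX_neq1 //.
    by rewrite subn_gt0 ltn_neqAle ab.
  rewrite -(subnKC ba) exprD mulrAC -exprMn zetaJ expr1n mul1r zetaX_neq1 //.
  by rewrite subn_gt0 ltn_neqAle eq_sym ab.
apply/eqP; have : (zeta ^+ a * conjc zeta ^+ b - 1) * cint (cmono a b k) == 0.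
  by rewrite mulrBl mul1r E subrr.
by rewrite mulf_eq0 subr_eq0 (negbTE zn).
Qed.

(** A Beta integral, by induction on [a]: the identity [|z|^2 * rad z = 1 - rad z] turns the
    integral for [a + 1] into a difference of two integrals for [a]. Writing the degree as [a + d]
    avoids truncated subtraction. *)
Lemma cint_cmono_diag a d :
  cint (cmono a a (a + d)) = ((a`! * d`!)%:R / (a + d).+1`!%:R : R)%:C%C.
Proof.
elim: a d => [|a IH] d.
  have -> : cmono 0 0 (0 + d) = fun z => (pi^-1 * rad z ^+ d.+2)%:C%C.
    by apply/funext => z; rewrite /cmono wtE !expr0 !mul1r.
  apply: complex_eq => /=; last by rewrite /Rintegral integral0.
  rewrite /Rintegral.
  under eq_integral => z _ do rewrite EFinM.
  rewrite ge0_integralZl //; last 3 first.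
  - by apply/measurable_EFinP; case: (tameX d.+2 (tame_rad R)).
  - by move=> z _; rewrite lee_fin exprn_ge0 // ltW // rad_gt0.
  - by rewrite lee_fin invr_ge0 pi_ge0.
  rewrite integral_rad -EFinM /= mul1n factS natrM.
  rewrite add0n mulrA mulVf ?mul1r ?gt_eqF ?pi_gt0 // invfM mulrCA divff ?mulr1 //.
have -> : cmono a.+1 a.+1 (a.+1 + d) =
    fun z => cmono a a (a + d) z + (-1) * cmono a a (a + d.+1) z.
  have wC j (z : R * R) : (pi^-1 * rad z ^+ j)%:C%C = (pi^-1)%:C%C * (rad z)%:C%C ^+ j.
    by rewrite (rmorphM (real_complex R)) (rmorphXn (real_complex R)).
  apply/funext => z; rewrite /cmono !wtE addSn addnS !wC.
  rewrite !exprS.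
  have e : cpt z * conjc (cpt z) * (rad z)%:C%C = 1 - (rad z)%:C%C.
    rewrite mulcJ normc_sqr -(rmorphM (real_complex R)) -[1]/((1:R)%:C%C).
    rewrite -(rmorphB (real_complex R)) /=; congr _%:C%C.
    have := rad_gt0 z; rewrite /rad /= invr_gt0 => h; field.
    by rewrite gt_eqF.
  transitivity (cpt z ^+ a * conjc (cpt z) ^+ a *
      ((pi^-1)%:C%C * ((rad z)%:C%C * ((rad z)%:C%C * ((rad z)%:C%C) ^+ (a + d)))) *
      (cpt z * conjc (cpt z) * (rad z)%:C%C)).
    by ring.
  by rewrite e; ring.
have i1 : cintegrable (cmono a a (a + d)) by apply: cintegrable_cmono; exact: leq_addr.
have i2 : cintegrable (cmono a a (a + d.+1)) by apply: cintegrable_cmono; exact: leq_addr.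
rewrite cintD //; last exact: cintegrableZ.
rewrite cintZ // !IH mulN1r -rmorphB; congr _%:C%C.
rewrite addSn addnS !factS !natrM.
have h : ((a + d)`!)%:R != 0 :> R by rewrite pnatr_eq0 -lt0n fact_gt0.
have h1 : (a + d).+1%:R != 0 :> R by rewrite pnatr_eq0.
have h2 : (a + d).+2%:R != 0 :> R by rewrite pnatr_eq0.
have e2 : (a + d).+2%:R = a%:R + d%:R + 2 :> R by rewrite -!natr1 natrD; ring.
have e1 : (a + d).+1%:R = a%:R + d%:R + 1 :> R by rewrite -!natr1 natrD.
rewrite -[a.+1%:R]natr1 -[d.+1%:R]natr1; rewrite e1 e2 in h1 h2 *.
by field; rewrite h h1 h2.
Qed.

End ComplexIntegral.

(** * The inner product in coefficients *)

Section HermitianForm.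
Variable R : realType.
Local Notation C := R[i].
Local Notation Re := complex.Re.
Local Notation Im := complex.Im.
Local Notation normc := (@ComplexField.Normc.normc R).
Local Notation lebC := (@lebC R).
Implicit Types (p q : {poly C}).

(** Algebraic form of [ipk] on polynomials of degree at most [k]: the monomials are orthogonal and
    ['X^a] has squared norm [1 / 'C(k, a)]. *)
Definition hip k p q : C := \sum_(a < k.+1) p`_a * conjc q`_a / 'C(k, a)%:R.

Lemma ipkE k (f g : C -> C) :
  ipk k f g = (k.+1%:R : R)%:C%C *
    cint (fun z => f (cpt z) * conjc (g (cpt z)) * (wt k (cpt z))%:C%C).
Proof.
apply: complex_eq; rewrite ?cReM ?cImM /= mul0r ?subr0 ?addr0; congr (_ * _).
  by apply: eq_Rintegral => z _; rewrite [RHS]cReM /= mulr0 subr0.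
by apply: eq_Rintegral => z _; rewrite [RHS]cImM /= mulr0 add0r mulrC.
Qed.

Lemma cint_cmono k (a b : 'I_k.+1) :
  (k.+1%:R : R)%:C%C * cint (cmono a b k) = ((a == b)%:R / 'C(k, a)%:R : C).
Proof.
case: eqVneq => [<-|ab]; last first.
  by rewrite cint_cmono_off ?mulr0 ?mul0r ?leq_ord.
have ak : (a <= k)%N by rewrite leq_ord.
have := cint_cmono_diag R a (k - a); rewrite subnKC // => ->; rewrite -(rmorphM (real_complex R)) mul1r.
have -> : ('C(k, a)%:R : C) = ('C(k, a)%:R : R)%:C%C by rewrite (rmorph_nat (real_complex R)).
rewrite -(fmorphV (real_complex R)); congr _%:C%C.
rewrite factS natrM -(bin_fact ak) !natrM.
have h1 : (k.+1%:R : R) != 0 by rewrite pnatr_eq0.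
have h2 : ('C(k, a)%:R : R) != 0 by rewrite pnatr_eq0 -lt0n bin_gt0.
have h3 : (a`!%:R : R) != 0 by rewrite pnatr_eq0 -lt0n fact_gt0.
have h4 : ((k - a)`!%:R : R) != 0 by rewrite pnatr_eq0 -lt0n fact_gt0.
move: h1 h2 h3 h4; move: k.+1%:R ('C(k,a)%:R) (a`!%:R) ((k - a)`!%:R) => A B D E h1 h2 h3 h4.
by field; rewrite h1 h2 h3 h4.
Qed.

Lemma ipk_hip k p q : (size p <= k.+1)%N -> (size q <= k.+1)%N ->
  ipk k (fun z => p.[z]) (fun z => q.[z]) = hip k p q.
Proof.
move=> sp sq; rewrite ipkE.
have E : (fun z => p.[cpt z] * conjc q.[cpt z] * (wt k (cpt z))%:C%C) =
    fun z => \sum_(a < k.+1) \sum_(b < k.+1) (p`_a * conjc q`_b) * cmono a b k z.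
  apply/funext => z; rewrite (horner_coef_wide _ sp) (horner_coef_wide _ sq).
  rewrite (rmorph_sum conjc) mulr_suml mulr_suml; apply: eq_bigr => a _.
  rewrite mulr_sumr mulr_suml; apply: eq_bigr => b _.
  by rewrite (rmorphM conjc) (rmorphXn conjc) /cmono; ring.
have I1 (a b : 'I_k.+1) : cintegrable (fun z => (p`_a * conjc q`_b) * cmono a b k z).
  by apply: cintegrableZ; apply: cintegrable_cmono; exact: leq_ord.
have I2 a := cint_sum (index_enum 'I_k.+1) (I1 a).
rewrite E (cint_sum _ (fun a => (I2 a).1)).2 mulr_sumr; apply: eq_bigr => a _.
rewrite (I2 a).2 mulr_sumr (bigD1 a) //= cintZ; last exact: cintegrable_cmono (leq_ord _) (leq_ord _).
rewrite mulrCA cint_cmono eqxx big1 ?addr0 ?mul1r // => b ba.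
rewrite cintZ; last exact: cintegrable_cmono (leq_ord _) (leq_ord _).
by rewrite mulrCA cint_cmono eq_sym (negbTE ba) mul0r mulr0.
Qed.

Lemma lebC_set1 (z : R * R) : lebC [set z] = 0%E.
Proof.
have -> : [set z] = [set z.1] `*` [set z.2].
  by apply/seteqP; split => [x -> //|[x y] [/= -> ->]]; case: z.
rewrite /lebC product_measure1E; [|exact: measurable_set1|exact: measurable_set1].
rewrite [X in (X * _)%E](_ : _ = 0%E) ?mul0e //; exact: (lebesgue_measure_set1 z.1).
Qed.

Lemma measurable_set1_prod (z : R * R) : measurable [set z].
Proof.
have -> : [set z] = [set z.1] `*` [set z.2].
  by apply/seteqP; split => [x -> //|[x y] [/= -> ->]]; case: z.
by apply: measurableX; exact: measurable_set1.
Qed.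

(** A point is a null set; [F] is measurable because it is [G] plus a multiple of the indicator of
    that point. This removes the pole of [phi] from the integrals. *)
Lemma Rintegral_off_point (F G : R * R -> R) (w : R * R) :
  measurable_fun setT G -> (forall z, z != w -> F z = G z) ->
  \int[lebC]_z F z = \int[lebC]_z G z.
Proof.
move=> mG FG.
have mF : measurable_fun setT F.
  have -> : F = (fun z => G z + (F w - G w) * \1_[set w] z).
    apply/funext => z; have [->|zw] := eqVneq z w.
      by rewrite indicE mem_set //= mulr1; ring.
    by rewrite FG // indicE memNset ?mulr0 ?addr0 //= => /eqP; rewrite (negbTE zw).
  apply: measurable_funD => //; apply: measurable_funM; first exact: measurable_cst.
  by apply: measurable_indic; exact: measurable_set1_prod.
rewrite /Rintegral; congr fine; apply: ae_eq_integral => //; try exact/measurable_EFinP.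
exists [set w]; split; [exact: measurable_set1_prod | exact: lebC_set1 |].
move=> z /= /not_implyP [_ h]; apply/eqP; apply/negPn/negP => zw.
by apply: h; rewrite FG.
Qed.

Lemma tameC_horner p : tameC (fun z => p.[cpt z]).
Proof.
elim/poly_ind: p => [|p c IH]; first by under eq_fun do rewrite horner0; exact: tameC_cst.
under eq_fun do rewrite hornerD hornerM hornerX hornerC.
have [h1 h2] := tameCM IH (tameC_cpt R); split.
  rewrite (_ : (fun z => _) = fun z => Re (p.[cpt z] * cpt z) + Re c).
    by apply: tameD => //; exact: tame_cst.
  by apply/funext => z; rewrite cReD.
rewrite (_ : (fun z => _) = fun z => Im (p.[cpt z] * cpt z) + Im c).
  by apply: tameD => //; exact: tame_cst.
by apply/funext => z; rewrite cImD.
Qed.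

Lemma ipk_off_point k p q (g : C -> C) (w : C) : (forall z, z != w -> g z = q.[z]) ->
  ipk k (fun z => p.[z]) g = ipk k (fun z => p.[z]) (fun z => q.[z]).
Proof.
move=> gq; rewrite !ipkE; congr (_ * _).
pose h := fun z : R * R => p.[cpt z] * conjc q.[cpt z] * (wt k (cpt z))%:C%C.
have [h1 h2] : tameC h.
  apply: tameCM; last exact: tameC_wt.
  by apply: tameCM; [|apply: tameC_conj]; exact: tameC_horner.
have off (z : R * R) : z != (Re w, Im w) ->
    p.[cpt z] * conjc (g (cpt z)) * (wt k (cpt z))%:C%C = h z.
  move=> zw; rewrite gq //; apply: contra zw => /eqP zw.
  by case: z zw => x y; case: w {gq} => a b [-> ->].
apply: complex_eq => /=.
  apply: (@Rintegral_off_point _ _ (Re w, Im w)); first by case: h1.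
  by move=> z zw; rewrite off.
apply: (@Rintegral_off_point _ _ (Re w, Im w)); first by case: h2.
by move=> z zw; rewrite off.
Qed.

End HermitianForm.

(** * Coherent states and rotated bases *)

Section CoherentStates.
Variable R : realType.
Local Notation C := R[i].
Local Notation Re := complex.Re.
Local Notation Im := complex.Im.
Local Notation normc := (@ComplexField.Normc.normc R).
Implicit Types (p q : {poly C}) (u v : C * C) (c : C).

Local Notation nsq c := (normc c ^+ 2).

Lemma cjM c d : conjc (c * d) = conjc c * conjc d. Proof. exact: rmorphM. Qed.
Lemma cjD c d : conjc (c + d) = conjc c + conjc d. Proof. exact: rmorphD. Qed.
Lemma cjN c : conjc (- c) = - conjc c. Proof. exact: rmorphN. Qed.
Lemma cjX c n : conjc (c ^+ n) = conjc c ^+ n. Proof. exact: rmorphXn. Qed.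
Lemma cjV c : conjc c^-1 = (conjc c)^-1. Proof. exact: fmorphV. Qed.
Lemma cj_nat n : conjc (n%:R : C) = n%:R. Proof. exact: rmorph_nat. Qed.
Lemma cj1 : conjc (1 : C) = 1. Proof. exact: rmorph1. Qed.
Lemma cj0 : conjc (0 : C) = 0. Proof. exact: rmorph0. Qed.
Lemma cjK c : conjc (conjc c) = c. Proof. exact: conjcK. Qed.
Lemma cj_sum (I : Type) (r : seq I) (P : pred I) (f : I -> C) :
  conjc (\sum_(i <- r | P i) f i) = \sum_(i <- r | P i) conjc (f i).
Proof. exact: rmorph_sum. Qed.

Lemma nsqM c d : nsq (c * d) = nsq c * nsq d.
Proof. by rewrite ComplexField.Normc.normcM exprMn. Qed.

Lemma nsqX c n : nsq (c ^+ n) = nsq c ^+ n.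
Proof. by rewrite normcX -!exprM mulnC. Qed.

Lemma nsq_conj c : nsq (conjc c) = nsq c.
Proof. by rewrite normc_conj. Qed.

Lemma nsq_real (x : R) : nsq (x%:C)%C = x ^+ 2.
Proof. by rewrite normc_real real_normK ?num_real. Qed.

Lemma nsq_ge0 c : 0 <= nsq c. Proof. exact: sqr_ge0. Qed.

Lemma nsqD_le c d : nsq (c + d) <= 2 * nsq c + 2 * nsq d.
Proof.
rewrite !normc_sqr cReD cImD -subr_ge0.
have -> : 2 * (Re c ^+ 2 + Im c ^+ 2) + 2 * (Re d ^+ 2 + Im d ^+ 2) -
  ((Re c + Re d) ^+ 2 + (Im c + Im d) ^+ 2) = (Re c - Re d) ^+ 2 + (Im c - Im d) ^+ 2 by ring.
by rewrite addr_ge0 // sqr_ge0.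
Qed.

(** Lagrange's identity: the double sum of the squares [(x i * y j - x j * y i) ^+ 2] is twice the
    deficit in the Cauchy-Schwarz inequality. *)
Lemma sum_mul_sqr_le (I : finType) (x y : I -> R) :
  (\sum_i x i * y i) ^+ 2 <= (\sum_i x i ^+ 2) * (\sum_i y i ^+ 2).
Proof.
have H : 0 <= \sum_i \sum_j (x i * y j - x j * y i) ^+ 2.
  by apply: sumr_ge0 => i _; apply: sumr_ge0 => j _; exact: sqr_ge0.
have E : \sum_i \sum_j (x i * y j - x j * y i) ^+ 2 =
    2 * ((\sum_i x i ^+ 2) * (\sum_i y i ^+ 2) - (\sum_i x i * y i) ^+ 2).
  have e1 : (\sum_i x i ^+ 2) * (\sum_i y i ^+ 2) = \sum_i \sum_j x i ^+ 2 * y j ^+ 2.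
    by rewrite mulr_suml; apply: eq_bigr => i _; rewrite mulr_sumr.
  have e2 : (\sum_i x i ^+ 2) * (\sum_i y i ^+ 2) = \sum_i \sum_j x j ^+ 2 * y i ^+ 2.
    by rewrite e1 exchange_big.
  have e3 : (\sum_i x i * y i) ^+ 2 = \sum_i \sum_j (x i * y i) * (x j * y j).
    by rewrite expr2 mulr_suml; apply: eq_bigr => i _; rewrite mulr_sumr.
  transitivity (\sum_i \sum_j (x i ^+ 2 * y j ^+ 2 + x j ^+ 2 * y i ^+ 2 +
      (-2) * ((x i * y i) * (x j * y j)))).
    by apply: eq_bigr => i _; apply: eq_bigr => j _; ring.
  have e4 : \sum_i \sum_j (-2) * ((x i * y i) * (x j * y j)) =
      (-2) * (\sum_i x i * y i) ^+ 2.
    by rewrite e3 mulr_sumr; apply: eq_bigr => i _; rewrite mulr_sumr.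
  under eq_bigr => i _ do rewrite !big_split /=.
  by rewrite !big_split /= -e1 -e2 e4; ring.
by move: H; rewrite E pmulr_rge0 // subr_ge0.
Qed.

Lemma nsq_sum_le (I : finType) (c d : I -> C) :
  nsq (\sum_i c i * d i) <= (\sum_i nsq (c i)) * (\sum_i nsq (d i)).
Proof.
have H : normc (\sum_i c i * d i) <= \sum_i normc (c i) * normc (d i).
  elim/big_ind2: _ => [|x1 x2 y1 y2 h1 h2|i _].
  - by rewrite ComplexField.Normc.normc0.
  - exact: le_trans (le_normcD _ _) (lerD h1 h2).
  - by rewrite ComplexField.Normc.normcM.
apply: le_trans (sum_mul_sqr_le _ _).
apply: lerXn2r => //; rewrite nnegrE ?normc_ge0 //.
by apply: sumr_ge0 => i _; rewrite mulr_ge0 // normc_ge0.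
Qed.

(** The difference is a polynomial of size at most [n] with the [n] distinct roots [0, ..., n - 1].
    This is how generating functions in [t] are compared below. *)
Lemma coef_inj_of_values n (c d : nat -> C) :
  (forall t : C, \sum_(j < n) c j * t ^+ j = \sum_(j < n) d j * t ^+ j) ->
  forall j, (j < n)%N -> c j = d j.
Proof.
move=> H; pose P := \poly_(j < n) (c j - d j).
have P0 : P = 0.
  apply/eqP; apply/negPn/negP => Pn0.
  pose rs := [seq (i%:R : C) | i <- iota 0 n].
  have ur : uniq rs by rewrite map_inj_uniq ?iota_uniq // => i j /eqP; rewrite eqr_nat => /eqP.
  have rr : all (root P) rs.
    apply/allP => x _; rewrite /root horner_poly.
    under eq_bigr do rewrite mulrBl.
    by rewrite sumrB H subrr.
  have := max_poly_roots Pn0 rr ur; rewrite size_map size_iota ltnNge size_poly //.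
move=> j jn; apply/eqP; rewrite -subr_eq0.
by have := coef_poly n (fun j => c j - d j) j; rewrite -/P P0 coef0 jn => <-.
Qed.

Lemma hipC k p q : hip k q p = conjc (hip k p q).
Proof.
rewrite /hip cj_sum; apply: eq_bigr => a _.
rewrite !cjM cjV cjK cj_nat.
by rewrite [q`_a * _]mulrC.
Qed.

Lemma hip_suml k (I : finType) (P : pred I) (c : I -> C) (f : I -> {poly C}) q :
  hip k (\sum_(i | P i) c i *: f i) q = \sum_(i | P i) c i * hip k (f i) q.
Proof.
rewrite /hip; under [RHS]eq_bigr do rewrite mulr_sumr.
rewrite exchange_big /=; apply: eq_bigr => a _.
rewrite coef_sum mulr_suml mulr_suml; apply: eq_bigr => i _.
by rewrite coefZ; ring.
Qed.

Lemma hip_sumr k (I : finType) (P : pred I) (c : I -> C) (f : I -> {poly C}) q :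
  hip k q (\sum_(i | P i) c i *: f i) = \sum_(i | P i) conjc (c i) * hip k q (f i).
Proof.
rewrite hipC hip_suml cj_sum; apply: eq_bigr => i _.
by rewrite cjM -hipC.
Qed.

Lemma hipDl k p p' q : hip k (p + p') q = hip k p q + hip k p' q.
Proof.
rewrite /hip -big_split; apply: eq_bigr => a _ /=.
by rewrite coefD; ring.
Qed.

Lemma hipDr k p p' q : hip k q (p + p') = hip k q p + hip k q p'.
Proof. by rewrite hipC hipDl cjD -!hipC. Qed.

Lemma hip_ge0 k p : 0 <= Re (hip k p p).
Proof.
rewrite /hip; elim/big_ind: _ => //= [x y x0 y0|a _].
  by rewrite cReD addr_ge0.
rewrite mulcJ -(rmorph_nat (real_complex R)) -(fmorphV (real_complex R)).
by rewrite -(rmorphM (real_complex R)) /= mulr_ge0 ?nsq_ge0 // invr_ge0.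
Qed.

(** * Linear forms on the space of pairs, their powers and the bases they generate *)

Definition hdot v u : C := v.1 * conjc u.1 + v.2 * conjc u.2.
Definition perp u : C * C := (conjc u.2, - conjc u.1).
(** The form [hdot w u] read in the affine chart [w = (1, X)]. *)
Definition lin u : {poly C} := (conjc u.1)%:P + conjc u.2 *: 'X.
Definition cohst k u : {poly C} := lin u ^+ k.
Definition lcomb (a b : C) u v : C * C := (a * u.1 + b * v.1, a * u.2 + b * v.2).
Definition sqbin k j : C := (Num.sqrt ('C(k, j)%:R : R))%:C%C.
(** The basis [e_j] carried to the point [u] and its antipode [perp u]; for [j > k] the factor
    [sqbin k j] makes it zero. *)
Definition rotbas k u j : {poly C} := sqbin k j *: (lin u ^+ (k - j) * lin (perp u) ^+ j).

Lemma sqbin_sqr k j : sqbin k j * sqbin k j = 'C(k, j)%:R.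
Proof.
rewrite /sqbin -(rmorphM (real_complex R)) -expr2 sqr_sqrtr ?ler0n //.
by rewrite (rmorph_nat (real_complex R)).
Qed.

Lemma sqbin_neq0 k j : (j <= k)%N -> sqbin k j != 0.
Proof.
move=> jk; apply/eqP => h; have := sqbin_sqr k j; rewrite h mul0r => /esym /eqP.
by rewrite pnatr_eq0 -leqn0 leqNgt bin_gt0 jk.
Qed.

Lemma nsq_sqbin k j : nsq (sqbin k j) = 'C(k, j)%:R.
Proof. by rewrite nsq_real sqr_sqrtr. Qed.

Lemma coef_cohst k u a : (a <= k)%N ->
  (cohst k u)`_a = 'C(k, a)%:R * conjc u.1 ^+ (k - a) * conjc u.2 ^+ a.
Proof.
move=> ak; rewrite /cohst /lin exprDn coef_sum.
have T (i : 'I_k.+1) : ((conjc u.1)%:P ^+ (k - i) * (conjc u.2 *: 'X) ^+ i *+ 'C(k, i))`_a =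
    if i == a :> nat then 'C(k, a)%:R * conjc u.1 ^+ (k - a) * conjc u.2 ^+ a else 0.
  rewrite exprZn coefMn -rmorphXn coefCM coefZ coefXn eq_sym.
  by case: eqP => [->|_] /=; rewrite ?mulr0 ?mul0rn // mulr1 -mulr_natl; ring.
under eq_bigr do rewrite T.
by rewrite -big_mkcond (big_pred1 (Ordinal (ak : (a < k.+1)%N))).
Qed.

(** Reproducing property: the product with [cohst k v] evaluates at [v] the homogenization of [p] in
    degree [k]. *)
Lemma hip_cohstr k p v :
  hip k p (cohst k v) = \sum_(a < k.+1) p`_a * (v.1 ^+ (k - a) * v.2 ^+ a).
Proof.
apply: eq_bigr => a _; have ak : (a <= k)%N by rewrite leq_ord.
rewrite coef_cohst // !cjM !cjX !cjK cj_nat.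
have : ('C(k, a)%:R : C) != 0 by rewrite pnatr_eq0 -lt0n bin_gt0.
by move: ('C(k, a)%:R : C) => N N0; field.
Qed.

Lemma hip_cohst k u v : hip k (cohst k u) (cohst k v) = hdot v u ^+ k.
Proof.
rewrite hip_cohstr /hdot exprDn; apply: eq_bigr => a _.
have ak : (a <= k)%N by rewrite leq_ord.
by rewrite coef_cohst // !exprMn -mulr_natl; ring.
Qed.

Lemma lin_lcomb a b u v : lin (lcomb a b u v) = (conjc a)%:P * lin u + (conjc b)%:P * lin v.
Proof.
rewrite /lin /lcomb /= !cjD !cjM !mulrDr !scalerDl.
rewrite !polyCD !polyCM -!mul_polyC !polyCM; ring.
Qed.

(** Binomial theorem, with ['C(k, j)] split into two factors [sqbin k j], one of them absorbed in
    [rotbas]. Coherent states thus act as generating functions of the basis. *)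
Lemma cohst_lcomb k a b u :
  cohst k (lcomb a b u (perp u)) =
  \sum_(j < k.+1) (sqbin k j * (conjc a ^+ (k - j) * conjc b ^+ j)) *: rotbas k u j.
Proof.
rewrite /cohst lin_lcomb exprDn; apply: eq_bigr => j _.
rewrite /rotbas scalerA mulrAC sqbin_sqr !exprMn -!rmorphXn /= -scaler_nat.
rewrite -scalerA scaler_nat -scaler_nat; congr (_ *: _).
by rewrite -mul_polyC polyCM; ring.
Qed.

Lemma hdot_lcombl a b u v w : hdot (lcomb a b u v) w = a * hdot u w + b * hdot v w.
Proof. by rewrite /hdot /lcomb /=; ring. Qed.

Lemma hdotC u v : hdot u v = conjc (hdot v u).
Proof.
by rewrite /hdot cjD !cjM !cjK [u.1 * _]mulrC [u.2 * _]mulrC.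
Qed.

Lemma hdot_lcombr a b u v w :
  hdot w (lcomb a b u v) = conjc a * hdot w u + conjc b * hdot w v.
Proof.
by rewrite hdotC hdot_lcombl cjD !cjM -!hdotC.
Qed.

(** Compare coefficients of [t ^+ j] in the product of [cohst k v] with the coherent state at
    [u + conjc t * perp u]. The conjugate cancels the one in [lin], so that both sides are
    polynomials in [t]. *)
Lemma hip_rotbas_cohst k u v j : (j <= k)%N ->
  hip k (rotbas k u j) (cohst k v) =
  sqbin k j * (hdot v u ^+ (k - j) * hdot v (perp u) ^+ j).
Proof.
move=> jk.
have := @coef_inj_of_values k.+1 (fun j => sqbin k j * hip k (rotbas k u j) (cohst k v))
  (fun j => 'C(k, j)%:R * (hdot v u ^+ (k - j) * hdot v (perp u) ^+ j)) _ j jk.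
rewrite -(sqbin_sqr k j) -mulrA => H; apply: (mulfI (sqbin_neq0 jk)); apply: H => t.
have := hip_cohst k (lcomb 1 (conjc t) u (perp u)) v.
rewrite cohst_lcomb hip_suml hdot_lcombr cj1 mul1r cjK exprDn => H.
transitivity (\sum_(i < k.+1) sqbin k i * (conjc 1 ^+ (k - i) * t ^+ i) * hip k (rotbas k u i) (cohst k v)).
  by apply: eq_bigr => i _; rewrite cj1 expr1n; ring.
rewrite cj1 H; apply: eq_bigr => i _.
by rewrite exprMn -mulr_natl; ring.
Qed.

Definition unitv u := hdot u u == 1.

Lemma hdot_perp u : hdot (perp u) u = 0.
Proof. by rewrite /hdot /perp /=; ring. Qed.
Lemma hdot_perpr u : hdot u (perp u) = 0.
Proof. by rewrite hdotC hdot_perp cj0. Qed.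
Lemma unitv_perp u : unitv u -> unitv (perp u).
Proof.
rewrite /unitv /hdot /perp /= !cjN !cjK => /eqP <-; apply/eqP; ring.
Qed.

(** The same comparison with the right argument at [u + t * perp u]: there [hip_rotbas_cohst]
    reduces to the single monomial [sqbin k i * t ^+ i]. *)
Lemma hip_rotbas k u i j : unitv u -> (i <= k)%N -> (j <= k)%N ->
  hip k (rotbas k u i) (rotbas k u j) = (i == j)%:R.
Proof.
move=> uu ik jk.
have := @coef_inj_of_values k.+1 (fun j => sqbin k j * hip k (rotbas k u i) (rotbas k u j))
  (fun j => sqbin k j * (i == j)%:R) _ j jk.
move=> H; apply: (mulfI (sqbin_neq0 jk)); apply: H => t.
have := hip_rotbas_cohst u (lcomb 1 t u (perp u)) ik.
rewrite cohst_lcomb hip_sumr !hdot_lcombl hdot_perp hdot_perpr.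
rewrite (eqP uu) (eqP (unitv_perp uu)) !mulr1 !mulr0 addr0 add0r expr1n mul1r => H.
transitivity (\sum_(j < k.+1) conjc (sqbin k j * (conjc 1 ^+ (k - j) * conjc t ^+ j))
   * hip k (rotbas k u i) (rotbas k u j)).
  apply: eq_bigr => l _; rewrite cj1 expr1n mul1r cjM cjX cjK.
  by rewrite /sqbin conjc_real; ring.
rewrite H (bigD1 (Ordinal (ik : (i < k.+1)%N))) //= eqxx mulr1 big1 ?addr0 // => l li.
by rewrite eq_sym (negbTE (li : (l : nat) != i)) mulr0 mul0r.
Qed.

Lemma rotbas_small k u j : (k < j)%N -> rotbas k u j = 0.
Proof. by move=> kj; rewrite /rotbas /sqbin bin_small // sqrtr0 scale0r. Qed.

Lemma hip0r k p : hip k p 0 = 0.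
Proof. by rewrite /hip big1 // => a _; rewrite coef0 cj0 mulr0 mul0r. Qed.

Lemma sum_le_of_vanishing (f : nat -> R) m k : (forall j, 0 <= f j) ->
  (forall j, (k < j)%N -> f j = 0) -> \sum_(j < m) f j <= \sum_(j < k.+1) f j.
Proof.
move=> f0 fz; apply: (@le_trans _ _ (\sum_(j < maxn m k.+1) f j)).
  rewrite -!(big_mkord xpredT f) (big_cat_nat_idem _ (leq0n m) (leq_maxl m k.+1)) //=; last exact: addr0.
  by rewrite lerDl sumr_ge0.
rewrite -!(big_mkord xpredT f) (big_cat_nat_idem _ (leq0n k.+1) (leq_maxr m k.+1)) //=; last exact: addr0.
by rewrite gerDl big_nat big1 // => j /andP[kj _]; rewrite fz.
Qed.

(** The vector [g] minus its projection has nonnegative squared norm. Indices beyond [k] add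
    nothing, so [m] is arbitrary. *)
Lemma bessel k u g m : unitv u ->
  \sum_(j < m) nsq (hip k g (rotbas k u j)) <= Re (hip k g g).
Proof.
move=> uu.
apply: (@le_trans _ _ (\sum_(j < k.+1) nsq (hip k g (rotbas k u j)))).
  apply: (sum_le_of_vanishing (f := fun j => nsq (hip k g (rotbas k u j)))) => j; first exact: nsq_ge0.
  by move=> kj; rewrite rotbas_small // hip0r ComplexField.Normc.normc0 expr0n.
pose c (j : 'I_k.+1) := hip k g (rotbas k u j).
(* [P] is minus the projection of [g], so the remainder is [g + P]. *)
pose P := \sum_(j < k.+1) (- c j) *: rotbas k u j.
have gP : hip k g P = - \sum_j (nsq (c j))%:C%C.
  rewrite hip_sumr -sumrN; apply: eq_bigr => j _.
  by rewrite cjN mulNr -mulcJ mulrC.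
have PP : hip k P P = \sum_j (nsq (c j))%:C%C.
  rewrite {1}/P hip_suml; apply: eq_bigr => i _.
  rewrite /P hip_sumr (bigD1 i) //= hip_rotbas ?leq_ord // eqxx big1 ?addr0.
    by rewrite mulr1 cjN mulrNN mulcJ.
  by move=> j ji; rewrite hip_rotbas ?leq_ord // eq_sym (negbTE (ji : (j : nat) != i)) mulr0.
have := hip_ge0 k (g + P); rewrite hipDl !hipDr !cReD [hip k P g]hipC cRe_conj gP PP.
rewrite -(rmorph_sum (real_complex R)) -(rmorphN (real_complex R)) /= => H.
rewrite -subr_ge0; apply: le_trans H _; rewrite le_eqVlt; apply/orP; left.
by apply/eqP; rewrite /c; ring.
Qed.

(** Pythagoras: [u] and [perp u] are orthogonal and of equal length. *)
Lemma hdot_lagrange u v :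
  nsq (hdot v u) + nsq (hdot v (perp u)) =
  (nsq v.1 + nsq v.2) * (nsq u.1 + nsq u.2).
Proof.
rewrite /hdot /perp; case: u v => [[a b] [c d]] [[a' b'] [c' d']].
by rewrite !normc_sqr /=; ring.
Qed.

Lemma unitv_nsq u : unitv u -> nsq u.1 + nsq u.2 = 1.
Proof.
rewrite /unitv /hdot !mulcJ => /eqP h; have := congr1 (fun c : C => Re c) h.
by rewrite cReD.
Qed.

Lemma nsq_hdot_perp u v : unitv u -> unitv v -> nsq (hdot v u) = 1 - nsq (hdot v (perp u)).
Proof.
move=> uu uv; have := hdot_lagrange u v; rewrite !unitv_nsq // mulr1 => <-.
by rewrite addrK.
Qed.

Lemma nsq_hdot_le1 u v : unitv u -> unitv v -> nsq (hdot v u) <= 1.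
Proof. by move=> uu uv; rewrite nsq_hdot_perp // gerBl nsq_ge0. Qed.

Lemma nsq_hip_cohst k u v j : unitv u -> unitv v ->
  nsq (hip k (cohst k v) (rotbas k u j)) = bpmf k (nsq (hdot v (perp u))) j.
Proof.
move=> uu uv; have [kj|jk] := ltnP k j.
  by rewrite rotbas_small // hip0r ComplexField.Normc.normc0 expr0n bpmf_small.
rewrite hipC nsq_conj hip_rotbas_cohst // !nsqM nsq_sqbin !nsqX nsq_hdot_perp //.
by rewrite /bpmf; ring.
Qed.

Lemma rotbas0 k u : rotbas k u 0 = cohst k u.
Proof. by rewrite /rotbas /cohst /sqbin bin0 sqrtr1 scale1r expr0 mulr1 subn0. Qed.

Lemma lcomb_hdot x v : unitv x -> v = lcomb (hdot v x) (hdot v (perp x)) x (perp x).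
Proof.
rewrite /unitv => /eqP h; case: v => a b; rewrite /lcomb /hdot /= !cjN !cjK.
congr (_, _).
  by transitivity (a * hdot x x); [rewrite h mulr1 | rewrite /hdot; ring].
by transitivity (b * hdot x x); [rewrite h mulr1 | rewrite /hdot; ring].
Qed.

(* Cut the coherent state at v along the basis adapted to x: the part of low
   index is controlled by Cauchy-Schwarz and the tail by Bessel. *)
Lemma local_trace_ge k m (x u v : C * C) (T : R) :
  unitv x -> unitv u -> unitv v -> 0 < T ->
  24^-1 <= blow k (nsq (hdot v (perp u))) m ->
  k%:R * nsq (hdot v (perp x)) <= T / 96 ->
  96^-1 <= \sum_(n < k.+1 | n%:R <= T)
    \sum_(j < m) nsq (hip k (rotbas k x n) (rotbas k u j)).
Proof.
move=> ux uu uv T0 lo hi.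
pose a := hdot v x; pose b := hdot v (perp x).
pose c (n : 'I_k.+1) := sqbin k n * (conjc a ^+ (k - n) * conjc b ^+ n).
have cn n : nsq (c n) = bpmf k (nsq b) n.
  rewrite /c !nsqM nsq_sqbin !nsqX !nsq_conj /a nsq_hdot_perp //.
  by rewrite /bpmf /b; ring.
have b01 : 0 <= nsq b <= 1 by rewrite nsq_ge0 nsq_hdot_le1 //; exact: unitv_perp.
pose G n := rotbas k x n.
pose L (n : 'I_k.+1) := (n%:R <= T).
pose Kl := \sum_(n < k.+1 | L n) c n *: G n.
pose Kh := \sum_(n < k.+1 | ~~ L n) c n *: G n.
have Kv : cohst k v = Kl + Kh.
  by rewrite {1}(lcomb_hdot v ux) cohst_lcomb (bigID L).
(* Markov's inequality for the binomial law of mean [k * nsq b], which is at most [T / 96]. *)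
have tail : \sum_(n < k.+1 | ~~ L n) nsq (c n) <= 96^-1.
  have M : T * \sum_(n < k.+1 | ~~ L n) nsq (c n) <= k%:R * nsq b.
    rewrite -(bexp_id k (nsq b)) /bexp mulr_sumr big_mkcond /=.
    apply: ler_sum => j _; rewrite cn /L -ltNge; case: ifP => Nj; last by rewrite mulr_ge0 // bpmf_ge0.
    by apply: ler_wpM2r; [exact: bpmf_ge0 | exact: ltW].
  by have := le_trans M hi; rewrite ler_pM2l.
have Khn : Re (hip k Kh Kh) = \sum_(n < k.+1 | ~~ L n) nsq (c n).
  rewrite {1}/Kh hip_suml.
  rewrite (eq_bigr (fun n => (nsq (c n))%:C%C)); last first.
    move=> i Li; rewrite /Kh hip_sumr (bigD1 i) //= hip_rotbas ?leq_ord // eqxx mulr1 big1 ?addr0.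
      by rewrite mulcJ.
    by move=> j /andP[_ ji]; rewrite hip_rotbas ?leq_ord // eq_sym (negbTE (ji : (j : nat) != i)) mulr0.
  by rewrite -(rmorph_sum (real_complex R)).
pose A n := \sum_(j < m) nsq (hip k (G n) (rotbas k u j)).
(* The coefficients [c n] have total squared mass 1, so Cauchy-Schwarz loses no constant. *)
have lowj j : nsq (hip k Kl (rotbas k u j)) <= \sum_(n < k.+1 | L n) nsq (hip k (G n) (rotbas k u j)).
  rewrite /Kl hip_suml big_mkcond [leRHS]big_mkcond /=.
  pose d n := if L n then hip k (G n) (rotbas k u j) else 0.
  rewrite (eq_bigr (fun n => c n * d n)); last by move=> n _; rewrite /d; case: ifP; rewrite ?mulr0.
  apply: le_trans (nsq_sum_le _ _) _.
  rewrite (eq_bigr _ (fun n _ => cn n)) sum_bpmf mul1r; apply: ler_sum => n _.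
  by rewrite /d; case: ifP; rewrite // ComplexField.Normc.normc0 expr0n.
have E : blow k (nsq (hdot v (perp u))) m = \sum_(j < m) nsq (hip k (Kl + Kh) (rotbas k u j)).
  by rewrite -Kv; apply: eq_bigr => j _; rewrite nsq_hip_cohst.
(* Since 1/24 is 4/96, subtracting the tail term 2/96 leaves 2/96, and the factor 2 in front of the
   low part gives 1/96. *)
have B : \sum_(j < m) nsq (hip k (Kl + Kh) (rotbas k u j)) <=
    2 * (\sum_(n < k.+1 | L n) A n) + 2 * 96^-1.
  apply: (@le_trans _ _ (\sum_(j < m) (2 * nsq (hip k Kl (rotbas k u j)) +
      2 * nsq (hip k Kh (rotbas k u j))))).
    by apply: ler_sum => j _; rewrite hipDl nsqD_le.
  rewrite big_split /= -!mulr_sumr; apply: lerD; rewrite ler_pM2l //.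
    by rewrite /A exchange_big; apply: ler_sum => j _; exact: lowj.
  by apply: le_trans (bessel _ _ _ uu) _; rewrite Khn.
rewrite E in lo; have := le_trans lo B; rewrite -/(A _).
by move: (\sum_(n < k.+1 | L n) A n) => S; lra.
Qed.

End CoherentStates.

(** * Sampling *)

Section Sampling.
Variable R : realType.
Local Notation C := R[i].
Local Notation Re := complex.Re.
Local Notation Im := complex.Im.
Local Notation normc := (@ComplexField.Normc.normc R).
Local Notation nsq c := (normc c ^+ 2).
Implicit Types (p q : {poly C}) (u v x : C * C) (z l : C).

Lemma hdot_self v : hdot v v = (nsq v.1 + nsq v.2)%:C%C.
Proof. by rewrite /hdot !mulcJ (rmorphD (real_complex R)). Qed.

(** The point [v] lies on the geodesic from [u] to [x]. If [d] and [r] are the sines of angles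
    [alpha] and [beta], then [v] is at sine distance [sin (alpha - beta)] from [x]. *)
Lemma exists_between x u (r d : R) : unitv x -> unitv u ->
  0 <= r -> r < d -> d < 1 -> nsq (hdot x (perp u)) = d ^+ 2 ->
  exists v, [/\ unitv v, nsq (hdot v (perp u)) = r ^+ 2 &
    (1 - d ^+ 2) * nsq (hdot v (perp x)) <= (d - r) ^+ 2].
Proof.
move=> ux uu r0 rd d1 hd.
have d0 : 0 < d by apply: le_lt_trans rd.
have rr : 0 < 1 - r ^+ 2 by rewrite subr_gt0 expr_lt1 // (lt_trans rd).
have dd : 0 < 1 - d ^+ 2 by rewrite subr_gt0 expr_lt1 // ltW.
pose A := Num.sqrt (1 - r ^+ 2); pose B := Num.sqrt (1 - d ^+ 2).
have A2 : A ^+ 2 = 1 - r ^+ 2 by rewrite sqr_sqrtr // ltW.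
have B2 : B ^+ 2 = 1 - d ^+ 2 by rewrite sqr_sqrtr // ltW.
have A0 : 0 < A by rewrite sqrtr_gt0.
have B0 : 0 < B by rewrite sqrtr_gt0.
pose a := hdot x u; pose b := hdot x (perp u).
have na : nsq a = B ^+ 2 by rewrite /a nsq_hdot_perp // hd B2.
(* The components of [x] along [u] and [perp u] keep their phases; their moduli change from [B], [d]
   to [A], [r], that is from the cosine and sine of [alpha] to those of [beta]. *)
pose v := lcomb (a * (A / B)%:C%C) (b * (r / d)%:C%C) u (perp u).
have vu : hdot v u = a * (A / B)%:C%C.
  by rewrite /v hdot_lcombl hdot_perp (eqP uu) mulr1 mulr0 addr0.
have vp : hdot v (perp u) = b * (r / d)%:C%C.
  by rewrite /v hdot_lcombl hdot_perpr (eqP (unitv_perp uu)) mulr1 mulr0 add0r.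
have nvp : nsq (hdot v (perp u)) = r ^+ 2.
  by rewrite vp nsqM nsq_real hd; field; rewrite gt_eqF.
have nvu : nsq (hdot v u) = A ^+ 2.
  by rewrite vu nsqM nsq_real na; field; rewrite gt_eqF.
have uv : unitv v.
  rewrite /unitv hdot_self; have := hdot_lagrange u v.
  by rewrite nvp nvu (unitv_nsq uu) mulr1 A2 subrK => <-.
exists v; split => //.
have vx : hdot v x = (A * B + d * r)%:C%C.
  rewrite {1}(lcomb_hdot x uu) hdot_lcombr vu vp -/a -/b.
  have -> : conjc a * (a * (A / B)%:C%C) + conjc b * (b * (r / d)%:C%C) =
    (a * conjc a) * (A / B)%:C%C + (b * conjc b) * (r / d)%:C%C by ring.
  rewrite !mulcJ na hd -!(rmorphM (real_complex R)) -(rmorphD (real_complex R)).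
  by congr _%:C%C; field; rewrite !gt_eqF.
have -> : nsq (hdot v (perp x)) = (d * A - r * B) ^+ 2.
  have := nsq_hdot_perp ux uv; rewrite vx nsq_real => h.
  have -> : nsq (hdot v (perp x)) = 1 - (A * B + d * r) ^+ 2 by rewrite h subKr.
  transitivity ((A ^+ 2 + r ^+ 2) * (B ^+ 2 + d ^+ 2) - (A * B + d * r) ^+ 2); last by ring.
  by rewrite A2 B2 !subrK mulr1.
rewrite -B2 -exprMn.
have BA : B <= A by rewrite ler_wsqrtr // lerD2l lerN2 lerXn2r // ?nnegrE ltW.
have e0 : 0 <= d * A - r * B.
  by rewrite subr_ge0 ler_pM // ltW.
apply: lerXn2r; rewrite ?nnegrE ?mulr_ge0 ?subr_ge0 ?(ltW B0) ?(ltW rd) //.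
  by rewrite -subr_ge0.
have dr0 : 0 < d + r by rewrite ltr_pwDl.
(* After multiplication by [d + r], the identity [d^2 - r^2 = sin (alpha - beta) * sin (alpha +
   beta)] reduces the claim to [B * (d + r) <= d * A + r * B], which follows from [B <= A]. *)
rewrite -(ler_pM2r dr0).
have -> : (d - r) * (d + r) = (d * A - r * B) * (d * A + r * B).
  by transitivity (d ^+ 2 * A ^+ 2 - r ^+ 2 * B ^+ 2); [rewrite A2 B2; ring | ring].
rewrite mulrAC mulrC ler_wpM2l //.
by rewrite mulrDr [B * d]mulrC [B * r]mulrC lerD2r ler_wpM2l // ltW.
Qed.

(** For unit [u], the diagonal entry, at the vector [rotbas k x n], of the projection onto the span
    of the [rotbas k u j] with [j < m]. *)
Definition ball_trace k m x u n : R :=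
  \sum_(j < m) nsq (hip k (rotbas k x n) (rotbas k u j)).

Lemma ball_trace_ge0 k m x u n : 0 <= ball_trace k m x u n.
Proof. by apply: sumr_ge0 => j _; exact: nsq_ge0. Qed.

(** For [d <= 1 / 2] apply [local_trace_ge] at the geodesic point with [r = sqrt (m / k)]. For
    larger [d] the cutoff [128 * tau ^+ 2] exceeds [k], so the sum is the full trace. *)
Lemma ball_trace_low k m x u (d : R) : unitv x -> unitv u -> 0 <= d ->
  nsq (hdot x (perp u)) = d ^+ 2 -> (0 < m)%N -> (16 * m <= k)%N ->
  let tau := Num.sqrt k%:R * d - Num.sqrt m%:R in 0 < tau ->
  96^-1 <= \sum_(n < k.+1 | n%:R <= 128 * tau ^+ 2) ball_trace k m x u n.
Proof.
move=> ux uu d0 hd m0 mk tau tau0.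
set s := Num.sqrt k%:R in tau tau0 *; set t := Num.sqrt m%:R in tau tau0 *.
have k0 : (0 < k)%N by rewrite (leq_trans _ mk) // muln_gt0.
have s0 : 0 < s by rewrite sqrtr_gt0 ltr0n.
have s2 : s ^+ 2 = k%:R by rewrite sqr_sqrtr.
have t0 : 0 < t by rewrite sqrtr_gt0 ltr0n.
have t2 : t ^+ 2 = m%:R by rewrite sqr_sqrtr.
have ts : 4 * t <= s.
  rewrite -(ler_pXn2r (_ : 0 < 2)%N) ?nnegrE ?mulr_ge0 ?(ltW t0) ?(ltW s0) // exprMn s2 t2.
  have -> : (4 : R) ^+ 2 * m%:R = (16 * m)%:R by rewrite natrM; ring.
  by rewrite ler_nat.
have [dle|dgt] := lerP d (1 / 2).
  have rd : t / s < d by rewrite ltr_pdivrMr // mulrC -subr_gt0.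
  have [v [uv hv1 hv2]] := exists_between ux uu (ltW (divr_gt0 t0 s0)) rd (ltac:(lra)) hd.
  apply: (@local_trace_ge _ k m x u v) => //.
  - by rewrite mulr_gt0 // exprn_gt0.
  - rewrite hv1 expr_div_n s2 t2; apply: blow_mean_ge => //.
    by rewrite (leq_trans _ mk) // -mul2n leq_mul2r orbT.
  (* Here [1 - d ^+ 2 >= 3 / 4] produces the factor 4/3 = 128/96, whence the constant 128 in the
     cutoff. *)
  - have td : tau = s * (d - t / s) by rewrite /tau; field; rewrite gt_eqF.
    have n0 := nsq_ge0 (hdot v (perp x)).
    have d2 : d ^+ 2 <= 1 / 4.
      have -> : (1 / 4 : R) = (1 / 2) ^+ 2 by field.
      by apply: lerXn2r => //; rewrite nnegrE.
    have e : nsq (hdot v (perp x)) <= 4 / 3 * (d - t / s) ^+ 2.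
      have : 3 / 4 * nsq (hdot v (perp x)) <= (1 - d ^+ 2) * nsq (hdot v (perp x)).
        by apply: ler_wpM2r => //; lra.
      by move=> h; have := le_trans h hv2; lra.
    rewrite td exprMn s2.
    move: e; move: (_ ^+ 2) ((d - t / s) ^+ 2) => X Y XY.
    have -> : 128 * (k%:R * Y) / 96 = k%:R * (4 / 3 * Y) :> R by lra.
    by rewrite ler_wpM2l.
(* From [d > 1 / 2] and [t <= s / 4] one gets [tau >= s / 4], hence [128 * tau ^+ 2 >= 8 * k]. *)
have all_n (n : 'I_k.+1) : (n%:R <= 128 * tau ^+ 2 :> R) = true.
  apply: (@le_trans _ _ k%:R); first by rewrite ler_nat leq_ord.
  have h : s / 4 <= tau by rewrite /tau; have := ltr_pM2l s0 (1 / 2) d; rewrite dgt => h; lra.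
  have h2 : (s / 4) ^+ 2 <= tau ^+ 2.
    by apply: lerXn2r; rewrite ?nnegrE ?divr_ge0 ?(ltW s0) ?(ltW tau0).
  have : k%:R <= 128 * (s / 4) ^+ 2 :> R by rewrite exprMn s2; have := ler0n R k; lra.
  by lra.
rewrite (eq_bigl _ _ all_n).
apply: (@le_trans _ _ 1); first by rewrite invf_le1 ?ler1n // ltr0n.
(* The index [j = 0] alone, the coherent state at [u], contributes total mass 1. *)
rewrite -(sum_bpmf k (nsq (hdot u (perp x)))); apply: ler_sum => n _.
rewrite -nsq_hip_cohst // hipC nsq_conj -rotbas0 /ball_trace.
case: (m) m0 => // m' _; rewrite big_ord_recl /= lerDl.
by apply: sumr_ge0 => j _; exact: nsq_ge0.
Qed.

(** Chosen so that [trace_ratio ^+ n >= exp (- tau^2 / 2)] whenever [n <= 128 * tau^2]. *)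
Definition trace_ratio : R := expR (- 256^-1).

(** Half of the exponent [tau^2] pays for the geometric weights, and the other half is at least
    [c^2 / 2]. *)
Lemma exp_le_ball_trace k m x u (d c : R) : unitv x -> unitv u -> 0 <= d ->
  nsq (hdot x (perp u)) = d ^+ 2 -> (0 < m)%N -> (16 * m <= k)%N ->
  let tau := Num.sqrt k%:R * d - Num.sqrt m%:R in 0 < c -> c <= tau ->
  expR (- tau ^+ 2) <=
  96 * expR (- (c ^+ 2 / 2)) * \sum_(n < k.+1) trace_ratio ^+ n * ball_trace k m x u n.
Proof.
move=> ux uu d0 hd m0 mk tau c0 ct.
have t0 : 0 < tau by apply: lt_le_trans ct.
have := ball_trace_low ux uu d0 hd m0 mk t0; rewrite -/tau => low.
have h1 : expR (- (tau ^+ 2 / 2)) * 96^-1 <= \sum_(n < k.+1) trace_ratio ^+ n * ball_trace k m x u n.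
  apply: (@le_trans _ _ (expR (- (tau ^+ 2 / 2)) *
      \sum_(n < k.+1 | n%:R <= 128 * tau ^+ 2) ball_trace k m x u n)).
    by rewrite ler_wpM2l // expR_ge0.
  rewrite mulr_sumr big_mkcond; apply: ler_sum => n _.
  have bt := ball_trace_ge0 k m x u n.
  case: ifP => hn; last by rewrite mulr_ge0 // exprn_ge0 // expR_ge0.
  by rewrite ler_wpM2r // /trace_ratio -expRM_natl ler_expR; lra.
apply: (@le_trans _ _ (96 * expR (- (c ^+ 2 / 2)) * (expR (- (tau ^+ 2 / 2)) * 96^-1))).
  have -> : 96 * expR (- (c ^+ 2 / 2)) * (expR (- (tau ^+ 2 / 2)) * 96^-1) =
    expR (- (c ^+ 2 / 2)) * expR (- (tau ^+ 2 / 2)) by field.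
  rewrite -expRD ler_expR.
  have : c ^+ 2 <= tau ^+ 2 by apply: lerXn2r; rewrite ?nnegrE ?(ltW c0) ?(ltW t0).
  by lra.
by rewrite ler_wpM2l // mulr_ge0 // expR_ge0.
Qed.

(** * Unit lifts of points of the plane, and the sampling sum expressed through them *)

Definition proj_pt l : C * C :=
  let s := (Num.sqrt (1 + nsq l))^-1%:C%C in (s, l * s).

Lemma sqrt1_gt0 l : 0 < Num.sqrt (1 + nsq l).
Proof. by rewrite sqrtr_gt0 ltr_pwDl // nsq_ge0. Qed.

Lemma unitv_proj_pt l : unitv (proj_pt l).
Proof.
have h0 : 0 < 1 + nsq l by rewrite ltr_pwDl // nsq_ge0.
rewrite /unitv hdot_self /proj_pt /= nsqM !nsq_real exprVn sqr_sqrtr ?ltW //.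
have -> : (1 + nsq l)^-1 + nsq l * (1 + nsq l)^-1 = 1 by field; rewrite gt_eqF.
by [].
Qed.

Lemma dch_ge0 l z : 0 <= dch l z.
Proof. by rewrite /dch divr_ge0 ?normc_ge0 // mulr_ge0 // sqrtr_ge0. Qed.

Lemma hdot_perpE u v : hdot v (perp u) = v.1 * u.2 - v.2 * u.1.
Proof. by rewrite /hdot /perp /= !cjN !cjK mulrN. Qed.

Lemma horner_lin u z : (lin u).[z] = conjc u.1 + conjc u.2 * z.
Proof. by rewrite /lin hornerD hornerC hornerZ hornerX. Qed.

Lemma horner_lin_perp u z : (lin (perp u)).[z] = u.2 - u.1 * z.
Proof. by rewrite horner_lin /perp /= cjN !cjK mulNr. Qed.

(** Up to sign, [hdot v (perp u)] is the determinant of the pair; for unit lifts its modulus is the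
    chordal distance. *)
Lemma nsq_hdot_proj_pt l z :
  nsq (hdot (proj_pt z) (perp (proj_pt l))) = dch l z ^+ 2.
Proof.
rewrite hdot_perpE /proj_pt.
set a := (Num.sqrt (1 + nsq z))^-1; set b := (Num.sqrt (1 + nsq l))^-1.
have -> : a%:C%C * (l * b%:C%C) - z * a%:C%C * b%:C%C = (l - z) * (b * a)%:C%C.
  by rewrite (rmorphM (real_complex R)); ring.
by rewrite nsqM nsq_real /dch invfM -/a -/b [RHS]exprMn.
Qed.

Lemma size_rotbas k u j : (size (rotbas k u j) <= k.+1)%N.
Proof.
have [kj|jk] := ltnP k j; first by rewrite rotbas_small // size_poly0.
have sl (w : C * C) : (size (lin w) <= 2)%N.
  apply: leq_trans (size_polyD _ _) _; rewrite geq_max; apply/andP; split.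
    by apply: leq_trans (size_polyC_leq1 _) _.
  by apply: leq_trans (size_scale_leq _ _) _; rewrite size_polyX.
have sX (w : C * C) n : (size (lin w ^+ n) <= n.+1)%N.
  apply: leq_trans (size_poly_exp_leq _ _) _; rewrite ltnS.
  by rewrite -[leqRHS]mul1n leq_mul2r; have := sl w; lia.
apply: leq_trans (size_scale_leq _ _) _.
apply: leq_trans (size_polyMleq _ _) _.
by have := sX u (k - j)%N; have := sX (perp u) j; lia.
Qed.

(** The prefactor clears the denominator of [phi l z ^+ j] and leaves [k - j] factors
    [1 + conjc l * z] and [j] factors [l - z]. Each one, divided by [sqrt (1 + |l|^2)], is a value
    of [lin]. *)
Lemma Tl_rotbas k l j z : 1 + conjc l * z != 0 ->
  Tl k l (ekj R k j) z = (rotbas k (proj_pt l) j).[z].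
Proof.
move=> D0; rewrite /Tl /ekj /rotbas -/(sqbin R k j) !hornerZ.
have [kj|jk] := ltnP k j.
  by rewrite /sqbin bin_small // sqrtr0 !mul0r mulr0.
rewrite hornerXn hornerM !horner_exp horner_lin_perp horner_lin /proj_pt.
rewrite [fst _]/= [snd _]/= cjM !conjc_real /phi.
have s0 : ((Num.sqrt (1 + nsq l))%:C%C : C) != 0.
  by rewrite -[0]/((0 : R)%:C%C) (inj_eq (@complexI R)) gt_eqF // sqrt1_gt0.
rewrite (fmorphV (real_complex R)) (rmorphXn (real_complex R)) /=.
set s := (_%:C%C) in s0 *; set D := 1 + conjc l * z in D0 *.
have -> : s^-1 + conjc l * s^-1 * z = D / s by rewrite /D; ring.
have -> : l * s^-1 - s^-1 * z = (l - z) / s by ring.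
have split_exp (c : C) : c ^+ k = c ^+ j * c ^+ (k - j) by rewrite -exprD subnKC.
rewrite !expr_div_n (split_exp D) (split_exp s).
have h1 : D ^+ j != 0 by rewrite expf_neq0.
have h2 : s ^+ j != 0 by rewrite expf_neq0.
have h3 : s ^+ (k - j) != 0 by rewrite expf_neq0.
by field; rewrite h1 h2 h3.
Qed.

(* At the pole of [phi l] the value of [Tl] is junk (division by 0), which the
   integral does not see. *)
Lemma ipk_Tl k l j p : (size p <= k.+1)%N ->
  ipk k (fun z => p.[z]) (Tl k l (ekj R k j)) = hip k p (rotbas k (proj_pt l) j).
Proof.
move=> sp; rewrite -ipk_hip ?size_rotbas //.
(* For [l = 0] the excluded point is 0 by the convention on inverses; there is no pole in that
   case. *)
apply: (@ipk_off_point _ _ _ _ _ (- (conjc l)^-1)) => z zw.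
apply: Tl_rotbas; apply: contra zw => /eqP h.
have l0 : conjc l != 0.
  by apply/eqP => l0; move: h; rewrite l0 mul0r addr0 => /eqP; rewrite oner_eq0.
apply/eqP; apply: (mulfI l0); rewrite mulrN divff //.
by apply/eqP; rewrite -subr_eq0 opprK addrC h.
Qed.

Lemma normk_sqr k p : (size p <= k.+1)%N ->
  normk k (fun z => p.[z]) ^+ 2 = Re (hip k p p).
Proof. by move=> sp; rewrite /normk ipk_hip // sqr_sqrtr // hip_ge0. Qed.

Lemma samp_sumE Lam m k p : (size p <= k.+1)%N ->
  samp_sum Lam m k p =
  \sum_(l <- Lam k) \sum_(j < m k l) nsq (hip k p (rotbas k (proj_pt l) j)).
Proof.
by move=> sp; apply: eq_bigr => l _; apply: eq_bigr => j _; rewrite ipk_Tl.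
Qed.

Lemma samp_sum_cohst Lam m k z :
  samp_sum Lam m k (cohst k (proj_pt z)) =
  \sum_(l <- Lam k) blow k (dch l z ^+ 2) (m k l).
Proof.
rewrite samp_sumE -?rotbas0 ?size_rotbas //; apply: eq_bigr => l _; apply: eq_bigr => j _.
by rewrite rotbas0 nsq_hip_cohst ?unitv_proj_pt // nsq_hdot_proj_pt.
Qed.

Lemma samp_sum_rotbas Lam m k z n :
  samp_sum Lam m k (rotbas k (proj_pt z) n) =
  \sum_(l <- Lam k) ball_trace k (m k l) (proj_pt z) (proj_pt l) n.
Proof. by rewrite samp_sumE // size_rotbas. Qed.

Lemma normk_rotbas k x n : unitv x -> (n <= k)%N ->
  normk k (fun z => (rotbas k x n).[z]) ^+ 2 = 1.
Proof. by move=> ux nk; rewrite normk_sqr ?size_rotbas // hip_rotbas // eqxx. Qed.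

Lemma dch_sqr_le1 l z : dch l z ^+ 2 <= 1.
Proof. by rewrite -nsq_hdot_proj_pt nsq_hdot_le1 ?unitv_perp ?unitv_proj_pt. Qed.

Lemma trace_ratio_lt1 : trace_ratio < 1.
Proof. by rewrite /trace_ratio expR_lt1 oppr_lt0 invr_gt0. Qed.

Lemma sum_trace_ratio_le k : \sum_(n < k.+1) trace_ratio ^+ n <= (1 - trace_ratio)^-1.
Proof.
have q1 : 0 < 1 - trace_ratio by rewrite subr_gt0 trace_ratio_lt1.
rewrite -[leRHS]mul1r ler_pdivlMr // mulrC.
have -> : (1 - trace_ratio) * \sum_(n < k.+1) trace_ratio ^+ n = 1 - trace_ratio ^+ k.+1.
  by rewrite -[1 - trace_ratio]opprB mulNr -subrX1 opprB.
by rewrite gerBl exprn_ge0 // expR_ge0.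
Qed.

End Sampling.

(** * Overlap bound and covering estimate for one degree [k] *)

Section Main.
Variable R : realType.
Local Notation C := R[i].
Variables (Lam : nat -> seq C) (m : nat -> C -> nat) (K : R).
Hypothesis HX : is_array Lam m.
Hypothesis K0 : 0 < K.
Hypothesis HK : forall k, (1 <= k)%N -> forall p : {poly C}, (size p <= k.+1)%N ->
  K^-1 * normk k (fun z => p.[z]) ^+ 2 <= samp_sum Lam m k p
  /\ samp_sum Lam m k p <= K * normk k (fun z => p.[z]) ^+ 2.

Lemma overlap_le k z : (1 <= k)%N -> (forall l, l \in Lam k -> (m k l).*2 <= k)%N ->
  \sum_(l <- Lam k) \1_(Dch l (Num.sqrt ((m k l)%:R / k%:R))) z <= 24 * K.
Proof.
move=> k1 mk; have k0 : (0 : R) < k%:R by rewrite ltr0n.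
have := (HK k1 (size_rotbas k (proj_pt z) 0)).2.
rewrite normk_rotbas ?unitv_proj_pt // mulr1 rotbas0 samp_sum_cohst => H.
apply: (@le_trans _ _ (24 * \sum_(l <- Lam k) blow k (dch l z ^+ 2) (m k l))); last first.
  by rewrite ler_pM2l.
rewrite mulr_sumr !big_seq; apply: ler_sum => l lk.
have m0 := (HX k1).2 _ lk.
rewrite indicE; case: (boolP (z \in _)) => [|_] /=; last first.
  rewrite mulr_ge0 //; apply: sumr_ge0 => j _; apply: bpmf_ge0.
  by rewrite sqr_ge0 dch_sqr_le1.
rewrite inE /Dch /= => dz; rewrite -ler_pdivrMl // mulr1.
apply: blow_ge => //; [exact: mk | exact: sqr_ge0 |].
(* Membership in the disc says that the mean [k * dch l z ^+ 2] is at most [m k l]. *)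
rewrite mulrC -ler_pdivlMr // -[leRHS]sqr_sqrtr ?divr_ge0 //.
by apply: lerXn2r; rewrite ?nnegrE ?dch_ge0 ?sqrtr_ge0 // ltW.
Qed.

(** An uncovered point [z] forces this inequality, which fails for large [c]. One factor [K] comes
    from the lower inequality for the coherent state at [z], the other from the upper inequality for
    the basis at [z], and the denominator from the geometric series. *)
Lemma covering_point k z (c : R) : (1 <= k)%N -> 0 < c ->
  (forall l, l \in Lam k -> 16 * m k l <= k)%N ->
  (forall l, l \in Lam k -> (Num.sqrt (m k l)%:R + c) / Num.sqrt k%:R <= dch l z) ->
  1 <= 96 * expR (- (c ^+ 2 / 2)) * (K ^+ 2 / (1 - trace_ratio R)).
Proof.
move=> k1 c0 mk far; have k0 : (0 : R) < k%:R by rewrite ltr0n.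
have s0 : 0 < Num.sqrt k%:R :> R by rewrite sqrtr_gt0.
have := (HK k1 (size_rotbas k (proj_pt z) 0)).1.
rewrite normk_rotbas ?unitv_proj_pt // mulr1 rotbas0 samp_sum_cohst => lo.
have up : \sum_(l <- Lam k) blow k (dch l z ^+ 2) (m k l) <=
    96 * expR (- (c ^+ 2 / 2)) * (K / (1 - trace_ratio R)).
  apply: (@le_trans _ _ (\sum_(l <- Lam k) 96 * expR (- (c ^+ 2 / 2)) *
      \sum_(n < k.+1) trace_ratio R ^+ n * ball_trace k (m k l) (proj_pt z) (proj_pt l) n)).
    rewrite !big_seq; apply: ler_sum => l lk.
    have m0 := (HX k1).2 _ lk.
    pose tau := Num.sqrt k%:R * dch l z - Num.sqrt (m k l)%:R.
    have ct : c <= tau.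
      by have := far l lk; rewrite /tau ler_pdivrMr // lerBrDl mulrC.
    apply: (@le_trans _ _ (expR (- tau ^+ 2))); last first.
      by apply: exp_le_ball_trace; rewrite ?unitv_proj_pt ?dch_ge0 ?nsq_hdot_proj_pt ?mk.
    have e : Num.sqrt (k%:R * dch l z ^+ 2) = Num.sqrt k%:R * dch l z.
      by rewrite sqrtrM // sqrtr_sqr ger0_norm // dch_ge0.
    rewrite /tau -e; apply: blow_chernoff => //.
      by rewrite sqr_ge0 dch_sqr_le1.
    have : Num.sqrt (m k l)%:R <= Num.sqrt k%:R * dch l z by move: ct; rewrite /tau; lra.
    by rewrite -e ler_sqrt // mulr_ge0 // sqr_ge0.
  (* Summed over [l] first, [ball_trace] is the sampling sum of a unit vector, hence at most [K]. *)
  rewrite -mulr_sumr ler_wpM2l ?mulr_ge0 ?expR_ge0 // exchange_big /=.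
  apply: (@le_trans _ _ (\sum_(n < k.+1) trace_ratio R ^+ n * K)); last first.
    by rewrite -mulr_suml mulrC ler_pM2l // sum_trace_ratio_le.
  apply: ler_sum => n _; rewrite -mulr_sumr ler_wpM2l ?exprn_ge0 ?expR_ge0 //.
  have := (HK k1 (size_rotbas k (proj_pt z) n)).2.
  by rewrite normk_rotbas ?unitv_proj_pt ?leq_ord // mulr1 samp_sum_rotbas.
have h := le_trans lo up; rewrite -(ler_pM2l K0) mulfV ?gt_eqF // in h.
apply: le_trans h _; rewrite le_eqVlt; apply/orP; left; apply/eqP.
by ring.
Qed.

End Main.

(** * Passage to all degrees: the threshold [k0] and the constant [c] *)

Theorem theorem1p2 (R : realType) (Lam : nat -> seq R[i]) (m : nat -> R[i] -> nat)
  (HX : is_array Lam m)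
  (Hm : (fun k : nat => ((\max_(l <- Lam k) m k l)%:R / k%:R : R)) @ \oo --> (0 : R))
  (Hs : L2_sampling Lam m) :
  (* (a) finite overlap *)
  (exists S : R, forall k : nat, (1 <= k)%N -> forall z : R[i],
      \sum_(l <- Lam k) \1_(Dch l (Num.sqrt ((m k l)%:R / k%:R))) z <= S)
  /\
  (* (b) covering *)
  (exists c : R, 0 < c /\ exists k0 : nat, forall k : nat, (k0 <= k)%N -> (1 <= k)%N ->
      \bigcup_(l in [set l | l \in Lam k])
         Dch l ((Num.sqrt (m k l)%:R + c) / Num.sqrt k%:R) = [set: R[i]]).
Proof.
have [K [K0 HK]] := Hs.
(* The limit hypothesis is used with tolerance 1/16; this one threshold serves both parts. *)
have [k0 Hk0] : exists k0, forall k, (k0 <= k)%N -> (1 <= k)%N ->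
    forall l, l \in Lam k -> (16 * m k l <= k)%N.
  have /cvgr0_norm_lt/(_ (16^-1)) := Hm.
  rewrite invr_gt0 ltr0n => /(_ isT) [k0 _ H].
  exists k0 => k kk k1 l lk; have := H k kk => /=.
  rewrite ger0_norm ?divr_ge0 // ltr_pdivrMr ?ltr0n // => h.
  rewrite -(ler_nat R) natrM; apply: le_trans (_ : 16 * (\max_(l <- Lam k) m k l)%:R <= _).
    by rewrite ler_wpM2l // ler_nat (leq_bigmax_seq _ lk).
  by rewrite -ler_pdivlMl // ltW.
split.
  (* The finitely many [k < k0] are covered by the trivial bound [size (Lam k)]. *)
  exists (24 * K + \sum_(k < k0) (size (Lam k))%:R) => k k1 z.
  have szge : 0 <= \sum_(k < k0) (size (Lam k))%:R :> R by apply: sumr_ge0.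
  have [kk|kk] := leqP k0 k.
    apply: (@le_trans _ _ (24 * K)); last by rewrite lerDl.
    apply: (overlap_le HX HK) => // l lk; apply: leq_trans (Hk0 k kk k1 l lk).
    by rewrite -mul2n leq_mul2r orbT.
  apply: (@le_trans _ _ (size (Lam k))%:R).
    rewrite -sum1_size natr_sum; apply: ler_sum => l _.
    by rewrite indicE lern1 leq_b1.
  rewrite (bigD1 (Ordinal kk)) //= addrCA lerDl addr_ge0 ?mulr_ge0 ?(ltW K0) //.
  by apply: sumr_ge0.
(* With [c = M + 2] one has [c^2 / 2 >= M], so the right side in [covering_point] is at most
   [M * exp (- M) <= M / (1 + M) < 1]. *)
pose M := 96 * (K ^+ 2 / (1 - trace_ratio R)).
have M0 : 0 < M by rewrite !(mulr_gt0, exprn_gt0, invr_gt0) // subr_gt0 trace_ratio_lt1.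
exists (M + 2); split; first by rewrite addr_gt0.
exists k0 => k kk k1; apply/seteqP; split=> // z _.
apply: contrapT => notin.
have := @covering_point _ _ _ _ HX K0 HK k z (M + 2) k1 (ltac:(lra)) (Hk0 k kk k1).
have -> : forall e : R, 96 * e * (K ^+ 2 / (1 - trace_ratio R)) = M * e by move=> e; rewrite /M; ring.
have far : forall l, l \in Lam k ->
    (Num.sqrt (m k l)%:R + (M + 2)) / Num.sqrt k%:R <= dch l z.
  by move=> l lk; rewrite leNgt; apply/negP => h; apply: notin; exists l.
move=> /(_ far); apply/negP; rewrite -ltNge.
have e1 : expR (- ((M + 2) ^+ 2 / 2)) <= expR (- M) by rewrite ler_expR; nra.
have e2 : expR (- M) <= (1 + M)^-1.
  by rewrite expRN lef_pV2 ?posrE ?expR_gt0 ?addr_gt0 // expR_ge1Dx.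
apply: (@le_lt_trans _ _ (M / (1 + M))).
  by rewrite ler_pM2l //; exact: le_trans e1 e2.
by rewrite ltr_pdivrMr ?addr_gt0 // mul1r ltrDr.
Qed.
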